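(* Let $\langle G,B,S,k,p_r\rangle$ be an instance of the Discovering Potential Attack Edges problem with $k\le|B|$. Let $A^*\subseteq B$ be a set of $k$ nodes of $B$ with the highest values of $(1-p_r(v))\cdot|\Gamma_{\text{in}}(v)\setminus(B\cup S)|$, that is, $|A^*|=k$ and for all $v\in A^*$ and $w\in B\setminus A^*$, $$(1-p_r(v))\cdot|\Gamma_{\text{in}}(v)\setminus(B\cup S)|\ \ge\ (1-p_r(w))\cdot|\Gamma_{\text{in}}(w)\setminus(B\cup S)|.$$ Then $A^*$ is an optimal solution: among all sets $A\subseteq B$ with $|A|=k$, it maximizes the expected number of potential attack edges discovered by revealing the resistances of the nodes of $A$. Moreover, such a set $A^*$ can be computed in linear time, i.e. in time $O(|V|+|E|)$.
   Context: An instance of the Discovering Potential Attack Edges problem is a tuple $\langle G,B,S,k,p_r\rangle$, where $G=(V,E)$ is a finite directed graph, $B,S\subseteq V$ are disjoint sets (the known benign nodes and the known sybil nodes), $k$ is a budget (a nonnegative integer), and $p_r:V\to[0,1]$. Each node $v$ has a resistance $r(v)\in\{0,1\}$, which is random with $\Pr[r(v)=1]=p_r(v)$, independently over nodes. For a node $v$, $\Gamma_{\text{in}}(v)=\{u:(u,v)\in E\}$ is its set of incoming neighbors. An edge $(u,v)\in E$ is a potential attack edge if $u\in V\setminus(B\cup S)$, $v\in B$ and $r(v)=0$. Revealing the resistance of a node $v\in B$ discovers all potential attack edges of the form $(u,v)$ (of which there are $|\Gamma_{\text{in}}(v)\setminus(B\cup S)|$ if $r(v)=0$, and none if $r(v)=1$).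 The goal is to choose $k$ nodes from $B$ whose resistances are revealed so as to maximize the expected number of discovered potential attack edges. Running time is measured in the standard unit-cost model (arithmetic operations on and comparisons of numbers take constant time), with $G$ given by adjacency lists. *)

(* Defs.v *)
From HB Require Import structures.
From mathcomp Require Import all_boot all_order all_algebra.
From mathcomp Require Import all_classical all_reals all_analysis.

Set Implicit Arguments.
Unset Strict Implicit.
Unset Printing Implicit Defensive.

Import Order.TTheory GRing.Theory Num.Theory.
Import numFieldNormedType.Exports.

Local Open Scope ring_scope.

(** * Instances *)

Record instance (R : realType) (V : finType) := Instance {
  edges : {set V * V} ;
  benign : {set V} ;
  sybil : {set V} ;
  budget : nat ;
  pr : V -> R ;
  benign_sybil_disjoint : [disjoint benign & sybil] ;
  pr_itv : forall v, 0 <= pr v <= 1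
}.

Section Problem.
Context (R : realType) (V : finType) (I : instance R V).
Implicit Types (A : {set V}) (u v w : V).

Definition in_neighbors v : {set V} := [set u | (u, v) \in edges I].

Definition potential_attack_edge (r : V -> bool) (e : V * V) : bool :=
  [&& e \in edges I, e.1 \notin benign I :|: sybil I, e.2 \in benign I
    & ~~ r e.2].

Definition discovered (r : V -> bool) A : {set V * V} :=
  [set e | potential_attack_edge r e & e.2 \in A].

Definition weight v : R :=
  (1 - pr I v) * #|in_neighbors v :\: (benign I :|: sybil I)|%:R.

Definition feasible A : Prop := A \subset benign I /\ #|A| = budget I.

Definition highest_weights A : Prop :=
  feasible A /\
  forall v w, v \in A -> w \in benign I :\: A -> weight w <= weight v.

End Problem.

(** * Independent resistances *)

Section Probability.
Context (R : realType) (V : finType).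
Context (d : measure_display) (T : measurableType d) (P : probability T R).

Definition independent_RVs (d' : measure_display) (T' : measurableType d')
    (X : V -> {RV P >-> T'}) : Prop :=
  forall (J : {set V}) (Y : V -> set T'),
    (forall v, measurable (Y v)) ->
    P [set x | forall v, v \in J -> Y v (X v x)]%classic =
    (\prod_(v in J) P (X v @^-1` Y v)%classic)%E.

Definition resistances (I : instance R V) (r : V -> {RV P >-> bool}) : Prop :=
  (forall v, P (r v @^-1` [set true])%classic = (pr I v)%:E) /\
  independent_RVs r.

Definition expected_discovered (I : instance R V) (r : V -> {RV P >-> bool})
    (A : {set V}) : \bar R :=
  'E_P[fun x => #|discovered I (fun v => r v x) A|%:R : R].

Definition optimal (I : instance R V) (r : V -> {RV P >-> bool})
    (A : {set V}) : Prop :=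
  feasible I A /\
  forall A', feasible I A' ->
    (expected_discovered I r A' <= expected_discovered I r A)%E.

End Probability.

(** * Unit-cost random access machine

  Programs are structured RAM programs.  The memory consists of unbounded
  arrays, named by natural numbers, with direct addressing: [nat_mem m a i] is
  the natural number stored at index [i] of array [a], and [real_mem m a i] is
  the real number stored there.  A program text contains only constant array
  names, so it uses finitely many arrays; a scalar variable is a fixed cell of
  some array.  There is no conversion from real numbers to natural numbers.
  The syntax does not depend on the input, so a program is one fixed
  algorithm for all instances. *)

Inductive nat_op := NAdd | NSub | NMul | NDiv.

Inductive real_op := RAdd | RSub | RMul | RDiv.

Inductive cmp_op := CEq | CLe | CLt.

Inductive nexp :=
| NConst of nat
| NGet of nat & nexp
| NOp of nat_op & nexp & nexp.

Inductive rexp :=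
| ROfNat of nexp
| RGet of nat & nexp
| ROp of real_op & rexp & rexp.

Inductive bexp :=
| NCmp of cmp_op & nexp & nexp
| RCmp of cmp_op & rexp & rexp
| BNot of bexp
| BAnd of bexp & bexp.

(* [Call f] runs the procedure number [f] of the program.  Procedures have no
   parameters or local variables: all the data they use are in the memory. *)
Inductive cmd :=
| Skip
| NSet of nat & nexp & nexp
| RSet of nat & nexp & rexp
| Seq of cmd & cmd
| If of bexp & cmd & cmd
| While of bexp & cmd
| Call of nat.

Record program := Program { procedures : seq cmd ; main : cmd }.

Record memory (R : realType) := Memory {
  nat_mem : nat -> nat -> nat ;
  real_mem : nat -> nat -> R
}.

Definition update (X : Type) (f : nat -> nat -> X) (a i : nat) (x : X) :
    nat -> nat -> X :=
  fun b j => if (b == a) && (j == i) then x else f b j.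

Section Semantics.
Context (R : realType).
Implicit Types (m : memory R) (a i n t : nat).

Definition set_nat m a i n : memory R :=
  Memory (update (nat_mem m) a i n) (real_mem m).

Definition set_real m a i (x : R) : memory R :=
  Memory (nat_mem m) (update (real_mem m) a i x).

(* Subtraction of natural numbers is truncated, division is the Euclidean
   quotient; dividing by zero gives zero for both sorts of numbers. *)
Definition eval_nat_op (o : nat_op) (x y : nat) : nat :=
  match o with
  | NAdd => (x + y)%N
  | NSub => (x - y)%N
  | NMul => (x * y)%N
  | NDiv => (x %/ y)%N
  end.

Definition eval_real_op (o : real_op) (x y : R) : R :=
  match o with
  | RAdd => x + y
  | RSub => x - y
  | RMul => x * y
  | RDiv => x / y
  end.

Definition eval_nat_cmp (o : cmp_op) (x y : nat) : bool :=
  match o with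
  | CEq => x == y
  | CLe => (x <= y)%N
  | CLt => (x < y)%N
  end.

Definition eval_real_cmp (o : cmp_op) (x y : R) : bool :=
  match o with
  | CEq => x == y
  | CLe => x <= y
  | CLt => x < y
  end.

Fixpoint eval_n m (e : nexp) : nat :=
  match e with
  | NConst n => n
  | NGet a e1 => nat_mem m a (eval_n m e1)
  | NOp o e1 e2 => eval_nat_op o (eval_n m e1) (eval_n m e2)
  end.

Fixpoint eval_r m (e : rexp) : R :=
  match e with
  | ROfNat e1 => (eval_n m e1)%:R
  | RGet a e1 => real_mem m a (eval_n m e1)
  | ROp o e1 e2 => eval_real_op o (eval_r m e1) (eval_r m e2)
  end.

Fixpoint eval_b m (b : bexp) : bool :=
  match b with
  | NCmp o e1 e2 => eval_nat_cmp o (eval_n m e1) (eval_n m e2)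
  | RCmp o e1 e2 => eval_real_cmp o (eval_r m e1) (eval_r m e2)
  | BNot b1 => ~~ eval_b m b1
  | BAnd b1 b2 => eval_b m b1 && eval_b m b2
  end.

(* Every constant, memory access, conversion, arithmetic operation,
   comparison and connective takes one unit of time. *)
Fixpoint cost_n (e : nexp) : nat :=
  match e with
  | NConst _ => 1
  | NGet _ e1 => (cost_n e1).+1
  | NOp _ e1 e2 => (cost_n e1 + cost_n e2).+1
  end.

Fixpoint cost_r (e : rexp) : nat :=
  match e with
  | ROfNat e1 => (cost_n e1).+1
  | RGet _ e1 => (cost_n e1).+1
  | ROp _ e1 e2 => (cost_r e1 + cost_r e2).+1
  end.

Fixpoint cost_b (b : bexp) : nat :=
  match b with
  | NCmp _ e1 e2 => (cost_n e1 + cost_n e2).+1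
  | RCmp _ e1 e2 => (cost_r e1 + cost_r e2).+1
  | BNot b1 => (cost_b b1).+1
  | BAnd b1 b2 => (cost_b b1 + cost_b b2).+1
  end.

(* [exec procs c m t m']: started in memory [m], the command [c] terminates
   after [t] units of time in memory [m'].  This relation is deterministic. *)
Inductive exec (procs : seq cmd) :
    cmd -> memory R -> nat -> memory R -> Prop :=
| ExecSkip m : exec procs Skip m 1 m
| ExecNSet m a e1 e2 :
    exec procs (NSet a e1 e2) m (cost_n e1 + cost_n e2).+1
      (set_nat m a (eval_n m e1) (eval_n m e2))
| ExecRSet m a e1 e2 :
    exec procs (RSet a e1 e2) m (cost_n e1 + cost_r e2).+1
      (set_real m a (eval_n m e1) (eval_r m e2))
| ExecSeq c1 c2 m1 m2 m3 t1 t2 :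
    exec procs c1 m1 t1 m2 -> exec procs c2 m2 t2 m3 ->
    exec procs (Seq c1 c2) m1 (t1 + t2) m3
| ExecIf b c1 c2 m m' t :
    exec procs (if eval_b m b then c1 else c2) m t m' ->
    exec procs (If b c1 c2) m (cost_b b + t).+1 m'
| ExecWhileFalse b c m :
    ~~ eval_b m b -> exec procs (While b c) m (cost_b b).+1 m
| ExecWhileTrue b c m1 m2 m3 t1 t2 :
    eval_b m1 b -> exec procs c m1 t1 m2 ->
    exec procs (While b c) m2 t2 m3 ->
    exec procs (While b c) m1 (cost_b b + t1 + t2).+1 m3
| ExecCall f m m' t :
    exec procs (nth Skip procs f) m t m' ->
    exec procs (Call f) m t.+1 m'.

Definition runs (p : program) m t m' : Prop :=
  exec (procedures p) (main p) m t m'.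

(** * Input and output of the algorithm *)

(* A linked list of cells: cell [c] holds the entry [nat_mem m dest c] and the
   address [nat_mem m next c] of the following cell; the address [0] ends the
   list. *)
Fixpoint linked_list m (dest next : nat) (c : nat) (s : seq nat) : Prop :=
  if s is x :: s' then
    [/\ c <> 0%N, nat_mem m dest c = x
      & linked_list m dest next (nat_mem m next c) s']
  else c = 0%N.

Definition arr_params : nat := 0.
Definition arr_head : nat := 1.
Definition arr_dest : nat := 2.
Definition arr_next : nat := 3.
Definition arr_benign : nat := 4.
Definition arr_sybil : nat := 5.
Definition arr_output : nat := 6.
Definition arr_pr : nat := 0.

(* The nodes are numbered by [id], in an arbitrary order, and [adj u] lists
   the out-neighbors of [u], also in an arbitrary order.  Cells of the input
   arrays that are not mentioned may have any content. *)
Record represents (V : finType) (I : instance R V) (id : V -> nat)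
    (adj : V -> seq V) m : Prop := Represents {
  id_inj : injective id ;
  id_lt : forall v, (id v < #|V|)%N ;
  adj_uniq : forall u, uniq (adj u) ;
  adj_edges : forall u v, (v \in adj u) = ((u, v) \in edges I) ;
  repr_size : nat_mem m arr_params 0 = #|V| ;
  repr_budget : nat_mem m arr_params 1 = budget I ;
  repr_adj : forall u, linked_list m arr_dest arr_next
    (nat_mem m arr_head (id u)) [seq id v | v <- adj u] ;
  repr_benign : forall v, nat_mem m arr_benign (id v) = (v \in benign I) ;
  repr_sybil : forall v, nat_mem m arr_sybil (id v) = (v \in sybil I) ;
  repr_pr : forall v, real_mem m arr_pr (id v) = pr I v ;
  nat_mem_init : forall a i, (arr_output <= a)%N -> nat_mem m a i = 0%N ;
  real_mem_init : forall a i, a <> arr_pr -> real_mem m a i = 0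
}.

Definition outputs (V : finType) (id : V -> nat) m (A : {set V}) : Prop :=
  forall v, nat_mem m arr_output (id v) = (v \in A).

End Semantics.

(* The time bound is O(|V| + |E|); the added 1 matters only for the graph
   without nodes, on which every run still takes positive time. *)
Definition computes_highest_weights_in_linear_time (R : realType)
    (p : program) : Prop :=
  exists C : nat, forall (V : finType) (I : instance R V) (id : V -> nat)
      (adj : V -> seq V) (m : memory R),
    (budget I <= #|benign I|)%N -> represents I id adj m ->
    exists (t : nat) (m' : memory R) (A : {set V}),
      [/\ runs p m t m', outputs id m' A, highest_weights I A
        & (t <= C * (#|V| + #|edges I| + 1))%N].

(* Main.v *)
Require Import Defs.
From mathcomp Require Import all_boot all_order all_algebra.
From mathcomp Require Import all_classical all_reals all_analysis.
From mathcomp Require Import measurable_realfun zify.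

(** By linearity of expectation a feasible set discovers, in expectation, the
    sum of the weights of its nodes.  Of two sets of the same size, the one with
    highest weights has the larger sum, by comparing the two set differences.

    The algorithm computes in-degrees from non-terminal nodes by traversing the
    adjacency lists once, then finds the [budget]-th largest weight [x] of a
    benign node by the median-of-medians selection of Blum, Floyd, Pratt, Rivest
    and Tarjan, and finally outputs the benign nodes of weight above [x],
    completed with nodes of weight exactly [x].  Selection on [n] numbers
    recurses on [n / 5] medians and then on at most about [7 n / 10] numbers,
    which gives linear time. *)

Set Implicit Arguments.
Unset Strict Implicit.
Unset Printing Implicit Defensive.

Import Order.TTheory GRing.Theory Num.Theory.
Local Open Scope ring_scope.

(** * Expectation and optimality *)

(** Because weights may coincide, ranks are handled as intervals: a number occupies every rank from
    the count of strictly larger entries up to, but excluding, the count of entries at least as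
    large. Such a rank depends on counts alone, not on the order in which the entries are stored.
    The other obstacle is that procedures share one global memory. Each specification therefore
    bounds the cells that may change. A selection keeps its input segment below a heap mark and
    writes to the heap only from that mark on, so medians, filtered numbers and deeper calls leave
    the input intact. Elapsed time is part of every postcondition, and the numerical constants are
    rounded up generously rather than tuned. *)

Section Expectation.
Context (R : realType) (V : finType) (I : instance R V).
Context (d : measure_display) (T : measurableType d) (P : probability T R).
Context (r : V -> {RV P >-> bool}).
Local Notation deg v := #|in_neighbors I v :\: (benign I :|: sybil I)|.

(** Group the discovered edges by target: those into [v] correspond to its in-neighbors outside
    [benign I :|: sybil I] when its resistance is 0, and there are none otherwise. *)
Lemma card_discovered (res : V -> bool) (A : {set V}) : A \subset benign I ->
  (#|discovered I res A| = \sum_(v in A) ~~ res v * deg v)%N.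
Proof.
move=> AB; rewrite -sum1_card.
rewrite (partition_big (fun e : V * V => e.2) (mem A)) /=; last first.
  by move=> e; rewrite inE => /andP[].
apply: eq_bigr => v vA; have vB := fintype.subsetP AB v vA.
rewrite sum1_card; case rv: (res v) => /=.
  rewrite mul0n; apply: eq_card0 => -[u w]; rewrite [LHS]unfold_in /= inE /potential_attack_edge /=.
  by case: eqP => [->|_]; rewrite ?andbF // rv !andbF.
rewrite mul1n -(card_imset _ (f := fun u => (u, v))) /=; last by move=> u w [].
apply: eq_card => -[u w]; rewrite [LHS]unfold_in /= inE /potential_attack_edge /=.
apply/andP/imsetP => [[/andP[/and4P[uwE uBS wB _] _] /eqP wv]|[x]].
  by exists u; rewrite -wv // finset.in_setD uBS inE.
rewrite finset.in_setD => /andP[xBS]; rewrite inE => xE [-> ->].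
by rewrite xE vB rv xBS vA.
Qed.

Lemma expected_discovered_weight (A : {set V}) :
  (forall v, P (r v @^-1` [set true])%classic = (pr I v)%:E) ->
  A \subset benign I -> expected_discovered I r A = (\sum_(v in A) weight I v)%:E.
Proof.
move=> rE AB; rewrite /expected_discovered unlock.
pose F v := (r v @^-1` [set false])%classic.
have mF v : measurable (F v).
  by rewrite /F -[X in measurable X]setTI; apply: measurable_funP.
have PF v : P (F v) = (1 - pr I v)%:E.
  rewrite (_ : F v = (~` (r v @^-1` [set true]))%classic).
    rewrite probability_setC ?rE //.
    by rewrite -[X in measurable X]setTI; apply: measurable_funP.
  by apply/seteqP; split=> x; rewrite /F /=; case: (r v x).
(* The count is a finite combination of indicators with nonnegative coefficients, so sum and
   integral can be exchanged. *)
rewrite (eq_integral (fun x => \sum_(v <- enum A) ((deg v)%:R%:E * (\1_(F v) x)%:E))%E); last first.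
  move=> x _; rewrite card_discovered // natr_sum -big_enum /= sumEFin.
  congr EFin; apply: eq_bigr => v _; rewrite natrM mulrC indicE.
  congr (_ * _%:R); congr nat_of_bool.
  by apply/idP/idP => [/negPf rx|/set_mem]; [apply: mem_set | rewrite /F /= => ->].
have mI v : measurable_fun (setT : set T) (EFin \o (\1_(F v) : T -> R)).
  exact/measurable_EFinP/measurable_indic.
rewrite ge0_integral_sum //.
- rewrite big_enum /= -sumEFin; apply: eq_bigr => v _.
  rewrite ge0_integralZl_EFin //; last exact: mI.
  rewrite integral_indic // setIT /weight mulrC EFinM; congr (_ * _)%E.
  exact: PF.
- by move=> v; apply: measurable_funeM; apply: mI.
Qed.

Lemma sum_highest_weights (A A' : {set V}) : highest_weights I A -> feasible I A' ->
  \sum_(v in A') weight I v <= \sum_(v in A) weight I v.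
Proof.
move=> [[AB cA] hA] [AB' cA'].
rewrite (big_setID A) [leRHS](big_setID A') /= (finset.setIC A) lerD2l.
have cD : #|A' :\: A| = #|A :\: A'|.
  by apply/eqP; rewrite -(eqn_add2l #|A' :&: A|) cardsID (finset.setIC A') cardsID cA cA'.
have [e|[a aD]] := set_0Vmem (A :\: A').
  move: cD; rewrite e cards0 => /eqP; rewrite cards_eq0 => /eqP->.
  by rewrite !big_set0.
(* The weight of [b] separates the two differences: nodes of [A' :\: A] weigh at most as much by
   [hA], nodes of [A :\: A'] at least as much, and both sets have the same size. *)
pose b := [arg min_(v < a in A :\: A') weight I v]%O.
have [bD bmin] : b \in A :\: A' /\ forall v, v \in A :\: A' -> weight I b <= weight I v.
  by rewrite /b; case: arg_minP.
have bA : b \in A by move: bD; rewrite finset.in_setD => /andP[].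
apply: (@le_trans _ _ (\sum_(v in A :\: A') weight I b)); last exact: ler_sum.
rewrite sumr_const -cD -sumr_const; apply: ler_sum => v.
rewrite finset.in_setD => /andP[vA vA']; apply: hA => //.
by rewrite finset.in_setD vA (fintype.subsetP AB').
Qed.

Lemma highest_weights_optimal (A : {set V}) :
  resistances I r -> highest_weights I A -> optimal I r A.
Proof.
move=> [rE _] hA; split=> [|A' fA']; first by case: hA.
have [[AB _] _] := hA; have [AB' _] := fA'.
by rewrite !expected_discovered_weight // lee_fin sum_highest_weights.
Qed.

End Expectation.

(** * Reasoning about programs *)

Arguments update _ _ _ _ _ _ _ /.

Section Framework.
Context (R : realType) (procs : seq cmd).
Implicit Types (m : memory R) (c : cmd) (Q : nat -> memory R -> Prop).

(* Total correctness; [Q] sees the elapsed time as well as the final memory. *)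
Definition wp c m Q := exists t m', exec procs c m t m' /\ Q t m'.

Lemma wp_conseq c m Q Q' :
  wp c m Q -> (forall t m', Q t m' -> Q' t m') -> wp c m Q'.
Proof. by move=> [t [m' [E q]]] QQ'; exists t, m'; split=> //; apply: QQ'. Qed.

Lemma wp_skip m Q : Q 1%N m -> wp Skip m Q.
Proof. by exists 1%N, m; split=> //; constructor. Qed.

Lemma wp_nset a e1 e2 m Q :
  Q (cost_n e1 + cost_n e2).+1 (set_nat m a (eval_n m e1) (eval_n m e2)) ->
  wp (NSet a e1 e2) m Q.
Proof. by move=> q; do 2 eexists; split; [constructor | exact: q]. Qed.

Lemma wp_rset a e1 e2 m Q :
  Q (cost_n e1 + cost_r e2).+1 (set_real m a (eval_n m e1) (eval_r m e2)) ->
  wp (RSet a e1 e2) m Q.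
Proof. by move=> q; do 2 eexists; split; [constructor | exact: q]. Qed.

Lemma wp_seq c1 c2 m Q :
  wp c1 m (fun t1 m1 => wp c2 m1 (fun t2 => Q (t1 + t2)%N)) ->
  wp (Seq c1 c2) m Q.
Proof.
move=> [t1 [m1 [E1 [t2 [m2 [E2 q]]]]]].
by exists (t1 + t2)%N, m2; split=> //; apply: ExecSeq E1 E2.
Qed.

Lemma wp_if b c1 c2 m Q :
  wp (if eval_b m b then c1 else c2) m (fun t => Q (cost_b b + t).+1) ->
  wp (If b c1 c2) m Q.
Proof.
move=> [t [m' [E q]]].
by exists (cost_b b + t).+1, m'; split=> //; constructor.
Qed.

Lemma wp_call f m Q :
  wp (nth Skip procs f) m (fun t => Q t.+1) -> wp (Call f) m Q.
Proof. by move=> [t [m' [E q]]]; exists t.+1, m'; split=> //; constructor. Qed.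

(** Fixing the number [N] of iterations in advance gives termination and the time bound at once. The
    cost [K j] may vary with the iteration, so that each node can be charged for its own adjacency
    list. *)
Lemma wp_while b c (K : nat -> nat) (Inv : nat -> memory R -> Prop) N m :
  Inv 0%N m ->
  (forall j m, (j < N)%N -> Inv j m ->
     eval_b m b /\ wp c m (fun t m' => (t <= K j)%N /\ Inv j.+1 m')) ->
  (forall m, Inv N m -> ~~ eval_b m b) ->
  wp (While b c) m (fun t m' =>
    (t <= \sum_(0 <= j < N) (K j + (cost_b b).+1) + (cost_b b).+1)%N /\ Inv N m').
Proof.
move=> I0 IS IN.
suff gen : forall d j m, (j + d = N)%N -> Inv j m -> wp (While b c) m (fun t m' =>
    (t <= \sum_(j <= i < N) (K i + (cost_b b).+1) + (cost_b b).+1)%N /\ Inv N m').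
  exact: (gen N 0%N).
elim=> [|d IH] j m' jN Ij.
  move: jN Ij; rewrite addn0 => -> IN'.
  exists (cost_b b).+1, m'; split; first by constructor; apply: IN.
  by split=> //; rewrite leq_addl.
have ltj : (j < N)%N by rewrite -jN addnS ltnS leq_addr.
have [eb [t1 [m1 [E1 [t1K I1]]]]] := IS j m' ltj Ij.
have [|t2 [m2 [E2 [t2K I2]]]] := IH j.+1 m1 _ I1; first by rewrite -jN addSnnS.
exists (cost_b b + t1 + t2).+1, m2; split; first exact: ExecWhileTrue eb E1 E2.
by split=> //; rewrite big_ltn //; lia.
Qed.

Lemma wp_while_const b c (K : nat) (Inv : nat -> memory R -> Prop) N m :
  Inv 0%N m ->
  (forall j m, (j < N)%N -> Inv j m ->
     eval_b m b /\ wp c m (fun t m' => (t <= K)%N /\ Inv j.+1 m')) ->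
  (forall m, Inv N m -> ~~ eval_b m b) ->
  wp (While b c) m (fun t m' =>
    (t <= N * (K + (cost_b b).+1) + (cost_b b).+1)%N /\ Inv N m').
Proof.
move=> I0 IS IN; apply: wp_conseq (wp_while (K := fun=> K) I0 IS IN) _ => t m'.
by rewrite sum_nat_const_nat subn0.
Qed.

(* [NA] and [RA] hold of the cells that may change. *)
Definition frame (NA RA : nat -> nat -> bool) m m' :=
  (forall a i, ~~ NA a i -> nat_mem m' a i = nat_mem m a i) /\
  (forall a i, ~~ RA a i -> real_mem m' a i = real_mem m a i).

Lemma frame_trans NA RA m1 m2 m3 :
  frame NA RA m1 m2 -> frame NA RA m2 m3 -> frame NA RA m1 m3.
Proof.
move=> [n12 r12] [n23 r23]; split=> a i H.
  by rewrite n23 // n12.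
by rewrite r23 // r12.
Qed.

Lemma frame_sub (NA RA NA' RA' : nat -> nat -> bool) m m' :
  (forall a i, NA a i -> NA' a i) -> (forall a i, RA a i -> RA' a i) ->
  frame NA RA m m' -> frame NA' RA' m m'.
Proof.
move=> sN sR [fN fR]; split=> a i H.
  by apply: fN; apply: contra H; apply: sN.
by apply: fR; apply: contra H; apply: sR.
Qed.

Lemma frame_set_nat NA RA m m' a i x :
  frame NA RA m m' -> NA a i -> frame NA RA m (set_nat m' a i x).
Proof.
move=> [fN fR] aN; split=> // b j H /=; rewrite /update.
by case: andP => [[/eqP ba /eqP ji]|_]; [rewrite ba ji aN in H | apply: fN].
Qed.

Lemma frame_set_real NA RA m m' a i x :
  frame NA RA m m' -> RA a i -> frame NA RA m (set_real m' a i x).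
Proof.
move=> [fN fR] aN; split=> // b j H /=; rewrite /update.
by case: andP => [[/eqP ba /eqP ji]|_]; [rewrite ba ji aN in H | apply: fR].
Qed.

Lemma set_nat_id m a i : set_nat m a i (nat_mem m a i) = m.
Proof.
case: m => n r; rewrite /set_nat /=; congr Memory.
apply/funext => b; apply/funext => j; rewrite /update.
by case: andP => // -[/eqP -> /eqP ->].
Qed.

(* Both branches in one formula: a boolean is added as a natural number. *)
Lemma wp_if_incr b a m Q :
  (forall t, (t <= cost_b b + 10)%N ->
     Q t (set_nat m a 0 (nat_mem m a 0 + eval_b m b))) ->
  wp (If b (NSet a (NConst 0) (NOp NAdd (NGet a (NConst 0)) (NConst 1))) Skip) m Q.
Proof.
move=> q; apply: wp_if; case eb: (eval_b m b) q => q.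
  by apply: wp_nset; apply: q => /=; lia.
apply: wp_skip; move: (q (cost_b b + 1).+1); rewrite addn0 set_nat_id; apply.
by lia.
Qed.

End Framework.

Local Notation cell a := (NGet a (NConst 0)).
Local Notation rcell a := (RGet a (NConst 0)).
Local Notation "a ::= e" := (NSet a (NConst 0) e) (at level 60).
Local Notation "c1 ;; c2" := (Seq c1 c2) (at level 65, right associativity).
Local Notation incr a := (NSet a (NConst 0) (NOp NAdd (NGet a (NConst 0)) (NConst 1))).

(* Scalars occupy cell 0 of their array.  The procedure [proc_select] keeps its
   arguments at index [v_sp] of the arrays [v_la] (start of a segment of the heap),
   [v_ln] (its length), [v_lk] (the rank) and [v_lt] (first free cell of the
   heap), so that [v_sp] is the depth of the recursion.  [Call 0], [Call 1] and
   [Call 2] run [proc_select], [proc_count] and [proc_brute]. *)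
Local Notation v_deg := 7%N.
Local Notation v_sp := 9%N.
Local Notation v_la := 10%N.
Local Notation v_ln := 11%N.
Local Notation v_lk := 12%N.
Local Notation v_lt := 13%N.
Local Notation v_i := 14%N.
Local Notation v_gt := 15%N.
Local Notation v_ge := 16%N.
Local Notation v_ca := 17%N.
Local Notation v_cn := 18%N.
Local Notation v_j := 19%N.
Local Notation v_ba := 20%N.
Local Notation v_bn := 21%N.
Local Notation v_bk := 22%N.
Local Notation v_g := 23%N.
Local Notation v_f := 24%N.
Local Notation v_fo := 25%N.
Local Notation v_x := 26%N.
Local Notation v_c := 27%N.
Local Notation r_heap := 1%N.
Local Notation r_wt := 2%N.
Local Notation r_res := 3%N.
Local Notation r_piv := 4%N.


(** The two counts are the ends of the interval of ranks that the pivot occupies. *)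
Definition proc_count : cmd :=
  v_i ::= NConst 0 ;; v_gt ::= NConst 0 ;; v_ge ::= NConst 0 ;;
  While (NCmp CLt (cell v_i) (cell v_cn))
   (let x := RGet r_heap (NOp NAdd (cell v_ca) (cell v_i)) in
    If (RCmp CLt (rcell r_piv) x) (incr v_gt) Skip ;;
    If (RCmp CLe (rcell r_piv) x) (incr v_ge) Skip ;;
    incr v_i).

(** Quadratic, hence called only on segments of bounded length: fewer than 30 numbers, or one group
    of five. *)
Definition proc_brute : cmd :=
  v_j ::= NConst 0 ;;
  While (NCmp CLt (cell v_j) (cell v_bn))
   (v_ca ::= cell v_ba ;; v_cn ::= cell v_bn ;;
    RSet r_piv (NConst 0) (RGet r_heap (NOp NAdd (cell v_ba) (cell v_j))) ;;
    Call 1 ;;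
    If (BAnd (NCmp CLe (cell v_gt) (cell v_bk)) (NCmp CLt (cell v_bk) (cell v_ge)))
      (RSet r_res (NConst 0) (rcell r_piv)) Skip ;;
    incr v_j).


Local Notation loc a := (NGet a (NGet v_sp (NConst 0))).

Definition filter_loop (up : bool) : cmd :=
  let x := RGet r_heap (NOp NAdd (loc v_la) (cell v_f)) in
  v_f ::= NConst 0 ;; v_fo ::= NConst 0 ;;
  While (NCmp CLt (cell v_f) (loc v_ln))
   (If (if up then RCmp CLt (rcell r_piv) x else RCmp CLt x (rcell r_piv))
      (RSet r_heap (NOp NAdd (loc v_lt) (cell v_fo)) x ;; incr v_fo) Skip ;;
    incr v_f).

(** A tail call: nothing remains to be done afterwards, so the arguments at the current depth are
    overwritten and the depth stays the same. The filtered numbers, written from the old heap mark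
    on, become the new segment. *)
Definition select_filtered (up : bool) : cmd :=
  filter_loop up ;;
  NSet v_la (cell v_sp) (loc v_lt) ;;
  NSet v_ln (cell v_sp) (cell v_fo) ;;
  NSet v_lt (cell v_sp) (NOp NAdd (loc v_lt) (cell v_fo)) ;;
  Call 0.

(** Rank 2, counted from 0, is the median of five. The at most four numbers after the last full
    group contribute no median. *)
Definition medians_loop : cmd :=
  v_g ::= NConst 0 ;;
  While (NCmp CLt (cell v_g) (NOp NDiv (loc v_ln) (NConst 5)))
   (v_ba ::= NOp NAdd (loc v_la) (NOp NMul (NConst 5) (cell v_g)) ;;
    v_bn ::= NConst 5 ;; v_bk ::= NConst 2 ;; Call 2 ;;
    RSet r_heap (NOp NAdd (loc v_lt) (cell v_g)) (rcell r_res) ;;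
    incr v_g).

(** The arguments of the call on the medians are stored one level deeper before [v_sp] moves,
    because [loc] reads at the current depth. Once the pivot is known the medians are dead, and
    filtering may overwrite them. *)
Definition proc_select : cmd :=
  If (NCmp CLt (loc v_ln) (NConst 30))
   (v_ba ::= loc v_la ;; v_bn ::= loc v_ln ;; v_bk ::= loc v_lk ;; Call 2)
   (medians_loop ;;
    let sp' := NOp NAdd (cell v_sp) (NConst 1) in
    let m := NOp NDiv (loc v_ln) (NConst 5) in
    NSet v_la sp' (loc v_lt) ;;
    NSet v_ln sp' m ;;
    NSet v_lk sp' (NOp NDiv m (NConst 2)) ;;
    NSet v_lt sp' (NOp NAdd (loc v_lt) m) ;;
    v_sp ::= sp' ;;
    Call 0 ;;
    v_sp ::= NOp NSub (cell v_sp) (NConst 1) ;;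
    v_ca ::= loc v_la ;; v_cn ::= loc v_ln ;;
    RSet r_piv (NConst 0) (rcell r_res) ;;
    Call 1 ;;
    If (NCmp CLt (loc v_lk) (cell v_gt)) (select_filtered true)
     (If (NCmp CLt (loc v_lk) (cell v_ge)) Skip
       (NSet v_lk (cell v_sp) (NOp NSub (loc v_lk) (cell v_ge)) ;;
        select_filtered false))).

(** * Counting, small selections and filtering *)

Section Loops.
Context (R : realType) (procs : seq cmd).
Implicit Types (m : memory R) (s : seq R).

Definition above (x : R) : pred R := fun y => x < y.
Definition atleast (x : R) : pred R := fun y => x <= y.

(* [x] has rank [k] in [s], counting from 0 and from the largest element. *)
Definition kth s k (x : R) : bool :=
  (count (above x) s <= k < count (atleast x) s)%N.

Definition seg m a s :=
  forall i, (i < size s)%N -> real_mem m r_heap (a + i) = nth 0 s i.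

Lemma count_take (a : pred R) s j : (j < size s)%N ->
  count a (take j.+1 s) = (count a (take j s) + a (nth 0%R s j))%N.
Proof. by move=> js; rewrite (take_nth 0) // -cats1 count_cat /= addn0. Qed.

Lemma count_spec m s a x :
  nth Skip procs 1 = proc_count ->
  nat_mem m v_ca 0 = a -> nat_mem m v_cn 0 = size s -> seg m a s ->
  real_mem m r_piv 0 = x ->
  wp procs (Call 1) m (fun t m' => [/\ (t <= 100 * (size s).+1)%N,
    nat_mem m' v_gt 0 = count (above x) s,
    nat_mem m' v_ge 0 = count (atleast x) s &
    frame (fun a _ => a \in [:: v_i; v_gt; v_ge]) (fun _ _ => false) m m']).
Proof.
move=> pE caE cnE sE xE; apply: wp_call; rewrite pE.
do 3! (apply: wp_seq; apply: wp_nset => /=).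
pose Inv j m' := [/\ nat_mem m' v_i 0 = j,
    nat_mem m' v_gt 0 = count (above x) (take j s),
    nat_mem m' v_ge 0 = count (atleast x) (take j s) &
    frame (fun a _ => a \in [:: v_i; v_gt; v_ge]) (fun _ _ => false) m m'].
apply: (wp_conseq (wp_while_const (K := 60) (Inv := Inv) (N := size s) _ _ _)).
- rewrite /Inv take0; split=> //.
  by do 3! apply: frame_set_nat => //.
- move=> j m' js [iE gtE geE F].
  have cnE' : nat_mem m' v_cn 0 = size s by rewrite F.1.
  have caE' : nat_mem m' v_ca 0 = a by rewrite F.1.
  have xE' : real_mem m' r_piv 0 = x by rewrite F.2.
  have hE' : real_mem m' r_heap (a + j) = nth 0 s j by rewrite F.2 // sE.
  split; first by rewrite /= iE cnE'.
  apply: wp_seq; apply: wp_if_incr => t1 /= t1K; rewrite iE caE' xE' hE' gtE.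
  apply: wp_seq; apply: wp_if_incr => t2 /= t2K; rewrite iE caE' xE' hE' geE.
  apply: wp_nset => /=; rewrite iE.
  split; first by lia.
  split=> //=; rewrite ?addn1 ?count_take //.
  by do 3! apply: frame_set_nat => //.
- by move=> m' [iE _ _ F] /=; rewrite iE F.1 // cnE ltnn.
move=> t m' [tN [_ gtE geE F]]; rewrite take_size in gtE geE; split=> //.
by move: tN => /=; lia.
Qed.

(** Take the entry at index [k] of the list sorted in decreasing order: strictly larger entries lie
    before it, and the first [k.+1] entries are all at least as large. *)
Lemma kth_exists s k : (k < size s)%N -> has (kth s k) s.
Proof.
move=> ks; pose s' := sort >=%O s; pose x := nth 0 s' k.
have ks' : (k < size s')%N by rewrite size_sort.
have ss : sorted >=%O s' by apply: sort_sorted => u v; rewrite /= le_total.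
apply/hasP; exists x; first by rewrite -(mem_sort >=%O) mem_nth.
have mono := sorted_leq_nth (leT := >=%O) ge_trans (@ge_refl _ _) 0 ss.
have pc (a : pred R) : count a s = count a s'.
  by apply/esym; apply/permP; rewrite perm_sort.
rewrite /kth !pc; apply/andP; split.
  rewrite -[s'](cat_take_drop k) count_cat [X in (_ + X)%N](_ : _ = 0%N).
    by rewrite addn0 (leq_trans (count_size _ _)) // size_take_min geq_minl.
  apply/eqP; rewrite -leqn0 leqNgt -has_count -all_predC; apply/allP => y.
  move=> /(nthP 0) [i]; rewrite size_drop nth_drop => ik <- /=.
  rewrite /above -leNgt; apply: mono; rewrite ?inE ?leq_addr //.
  by rewrite -ltn_subRL; exact: ik.
have -> : count (atleast x) s' = (count (atleast x) (take k.+1 s') + count (atleast x) (drop k.+1 s'))%N.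
  by rewrite -count_cat cat_take_drop.
suff -> : count (atleast x) (take k.+1 s') = k.+1 by rewrite leq_addr.
have sk : size (take k.+1 s') = k.+1 by rewrite size_takel.
rewrite -[RHS]sk; apply/eqP; rewrite -all_count; apply/allP => y /(nthP 0) [i].
rewrite sk => ik; rewrite nth_take // => <-.
by apply: mono; rewrite ?inE // (leq_trans ik).
Qed.

Lemma brute_spec m s a k :
  nth Skip procs 1 = proc_count -> nth Skip procs 2 = proc_brute ->
  nat_mem m v_ba 0 = a -> nat_mem m v_bn 0 = size s -> nat_mem m v_bk 0 = k ->
  (k < size s)%N -> seg m a s ->
  wp procs (Call 2) m (fun t m' => [/\ (t <= 400 * ((size s).+1 * (size s).+1))%N,
    kth s k (real_mem m' r_res 0) &
    frame (fun a _ => 14 <= a <= 19)%N (fun a _ => a \in [:: r_res; r_piv]) m m']).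
Proof.
move=> pc pb aE nE kE ks sE; apply: wp_call; rewrite pb.
apply: wp_seq; apply: wp_nset => /=.
pose F := frame (R := R) (fun a _ => 14 <= a <= 19)%N (fun a _ => a \in [:: r_res; r_piv]).
(* The content of [r_res] is constrained only once an entry of rank [k] has been met; [kth_exists]
   guarantees that the full scan meets one. *)
pose Inv j m' := [/\ nat_mem m' v_j 0 = j,
   has (kth s k) (take j s) -> kth s k (real_mem m' r_res 0) & F m m'].
apply: (wp_conseq (wp_while_const (K := 200 * (size s).+1) (Inv := Inv) (N := size s) _ _ _)).
- rewrite /Inv take0; split=> //.
  by apply: frame_set_nat.
- move=> j m' js [jE hE Fm].
  split; first by rewrite /= jE Fm.1 // nE.
  do 2! (apply: wp_seq; apply: wp_nset => /=).
  apply: wp_seq; apply: wp_rset => /=; rewrite !jE !Fm.1 // aE nE Fm.2 // sE //.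
  apply: wp_seq; apply: wp_conseq (count_spec (s := s) (a := a) (x := nth 0 s j) pc _ _ _ _) _ => //=.
    by move=> i il /=; rewrite Fm.2 // sE.
  move=> t m1 [tK gtE geE F1].
  have F2 : F m m1.
    apply: frame_trans (frame_sub _ _ F1); last 2 first.
    - by move=> b i; rewrite !inE => /or3P[] /eqP->.
    - by [].
    apply: frame_set_real => //.
    by do 2! apply: frame_set_nat => //.
  have jE1 : nat_mem m1 v_j 0 = j by rewrite F1.1.
  have pE1 : real_mem m1 r_piv 0 = nth 0 s j by rewrite F1.2.
  have rE1 : real_mem m1 r_res 0 = real_mem m' r_res 0 by rewrite F1.2.
  apply: wp_seq; apply: wp_if => /=; rewrite gtE geE F2.1 // kE.
  have htake : has (kth s k) (take j.+1 s) = has (kth s k) (take j s) || kth s k (nth 0 s j).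
    by rewrite (take_nth 0) // has_rcons orbC.
  case: ifPn => b; [apply: wp_rset => /= | apply: wp_skip]; apply: wp_nset => /=;
    rewrite jE1; (split; first by lia); rewrite /Inv /= ?pE1 addn1; split=> //.
  + by apply: frame_set_nat => //; apply: frame_set_real.
  + by rewrite htake [kth s k (nth 0 s j)](negPf b) orbF rE1.
  + by apply: frame_set_nat.
- by move=> m' [jE _ Fm] /=; rewrite jE Fm.1 // nE ltnn.
move=> t m' [tN [_ hE Fm]]; split=> //.
- by move: tN => /=; nia.
- by apply: hE; rewrite take_size kth_exists.
Qed.

Definition side (up : bool) (x : R) : pred R :=
  fun y => if up then x < y else y < x.

(** The condition [a + size s <= top] keeps source and target apart, so the entries still to be read
    are not overwritten. *)
Lemma filter_spec up m s a x sp top :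
  nat_mem m v_sp 0 = sp -> nat_mem m v_la sp = a -> nat_mem m v_ln sp = size s ->
  nat_mem m v_lt sp = top -> (a + size s <= top)%N -> real_mem m r_piv 0 = x ->
  seg m a s ->
  wp procs (filter_loop up) m (fun t m' => [/\ (t <= 100 * (size s).+1)%N,
    nat_mem m' v_fo 0 = size (seq.filter (side up x) s),
    seg m' top (seq.filter (side up x) s) &
    frame (fun a _ => a \in [:: v_f; v_fo])
      (fun a i => (a == r_heap) && (top <= i)%N) m m']).
Proof.
move=> spE aE nE tE atop xE sE.
do 2! (apply: wp_seq; apply: wp_nset => /=).
pose F := frame (R := R) (fun a _ => a \in [:: v_f; v_fo])
      (fun a i => (a == r_heap) && (top <= i)%N).
pose Inv j m' := [/\ nat_mem m' v_f 0 = j,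
  nat_mem m' v_fo 0 = size (seq.filter (side up x) (take j s)),
  seg m' top (seq.filter (side up x) (take j s)) & F m m'].
apply: (wp_conseq (wp_while_const (K := 60) (Inv := Inv) (N := size s) _ _ _)).
- rewrite /Inv take0; split=> //.
  by do 2! apply: frame_set_nat => //.
- move=> j m' js [jE fE sE' Fm].
  have spE' : nat_mem m' v_sp 0 = sp by rewrite Fm.1.
  have aE' : nat_mem m' v_la sp = a by rewrite Fm.1.
  have tE' : nat_mem m' v_lt sp = top by rewrite Fm.1.
  have xE' : real_mem m' r_piv 0 = x by rewrite Fm.2.
  have hE' : real_mem m' r_heap (a + j) = nth 0 s j.
    by rewrite Fm.2 ?sE //= -ltnNge; lia.
  split; first by rewrite /= jE spE' Fm.1 // nE.
  have tk : seq.filter (side up x) (take j.+1 s) = if side up x (nth 0 s j) then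
      rcons (seq.filter (side up x) (take j s)) (nth 0 s j)
      else seq.filter (side up x) (take j s).
    by rewrite (take_nth 0) // filter_rcons.
  apply: wp_seq; apply: wp_if.
  have -> : eval_b m' (if up then RCmp CLt (rcell r_piv) (RGet r_heap (NOp NAdd (loc v_la) (cell v_f)))
     else RCmp CLt (RGet r_heap (NOp NAdd (loc v_la) (cell v_f))) (rcell r_piv))
     = side up x (nth 0 s j).
    by rewrite /side; case: (up) => /=; rewrite jE spE' aE' hE' xE'.
  have -> : cost_b (if up then RCmp CLt (rcell r_piv) (RGet r_heap (NOp NAdd (loc v_la) (cell v_f)))
     else RCmp CLt (RGet r_heap (NOp NAdd (loc v_la) (cell v_f))) (rcell r_piv)) = 10%N.
    by case: (up).
  case: ifPn => b.
    apply: wp_seq; apply: wp_rset => /=; rewrite jE fE spE' aE' tE' hE'.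
    apply: wp_nset => /=; apply: wp_nset => /=; rewrite jE fE.
    split=> //; rewrite /Inv tk b size_rcons !addn1; split=> //=.
      move=> i; rewrite size_rcons ltnS leq_eqVlt nth_rcons /= eqn_add2l => /orP[/eqP->|il].
        by rewrite ltnn eqxx.
      by rewrite il (ltn_eqF il) sE'.
    do 2! apply: frame_set_nat => //; apply: frame_set_real => //=.
    by rewrite leq_addr.
  apply: wp_skip; apply: wp_nset => /=; rewrite jE; split=> //.
  rewrite /Inv tk (negPf b) addn1; split=> //=.
  by apply: frame_set_nat.
- by move=> m' [jE _ _ Fm] /=; rewrite jE (Fm.1 v_sp) // spE Fm.1 // nE ltnn.
move=> t m' [tN [_ fE sE' Fm]]; rewrite take_size in fE sE'; split=> //.
by move: tN => /=; lia.
Qed.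

End Loops.

(** * The median of medians *)

Section Pivot.
Context (R : realType).
Implicit Types (s : seq R) (p t : R).

(** The groups are disjoint slices of [s], so their contributions add up. *)
Lemma count_groups (P : pred R) s m (q : nat -> R) :
  (forall j, (j < m)%N -> P (q j) -> (3 <= count P (take 5 (drop (5 * j) s)))%N) ->
  (3 * count P (mkseq q m) <= count P (take (5 * m) s))%N.
Proof.
elim: m => [|m IH] H; first by rewrite muln0.
rewrite mkseqS -cats1 count_cat mulnS (addnC 5) takeD count_cat mulnDr.
apply: leq_add; first by apply: IH => j jm; apply: H; apply: ltnW.
by rewrite /= addn0; case Pq: (P (q m)) => //=; rewrite ?muln0 // muln1; apply: H.
Qed.

(* Every median on one side of [p] brings three elements of its group of five
   to that side. *)
Lemma pivot_balanced s m (q : nat -> R) p : m = (size s %/ 5)%N ->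
  (forall j, (j < m)%N -> kth (take 5 (drop (5 * j) s)) 2 (q j)) ->
  kth (mkseq q m) (m %/ 2) p ->
  (count (above p) s + 3 * (m - m %/ 2) <= size s /\
   count (side false p) s + 3 * (m - m %/ 2) <= size s)%N.
Proof.
move=> mE kq /andP[k1 k2].
(* Numbers after the last full group can only increase a count. *)
have tk (P : pred R) : (count P (take (5 * m) s) <= count P s)%N.
  by rewrite -[in leqRHS](cat_take_drop (5 * m) s) count_cat leq_addr.
have szg j : (j < m)%N -> size (take 5 (drop (5 * j) s)) = 5%N.
  by move=> jm; rewrite size_takel // size_drop; lia.
have cA P (u : seq R) : (count P u + count (predC P) u = size u)%N by rewrite count_predC.
split.
  have := @count_groups (predC (above p)) s m q; rewrite /= => H.
  have {}H : (3 * count (predC (above p)) (mkseq q m) <= count (predC (above p)) (take (5 * m) s))%N.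
    apply: H => j jm qp; have /andP[g1 _] := kq j jm.
    have := cA (above (q j)) (take 5 (drop (5 * j) s)); rewrite szg // => e.
    apply: (@leq_trans (count (predC (above (q j))) (take 5 (drop (5 * j) s)))); first by lia.
    apply: sub_count => y /=; rewrite /above -!leNgt => yq; apply: le_trans yq _.
    by move: qp; rewrite /above -leNgt.
  have := tk (predC (above p)); have := cA (above p) s; have := cA (above p) (mkseq q m).
  rewrite size_mkseq; lia.
have H : (3 * count (atleast p) (mkseq q m) <= count (atleast p) (take (5 * m) s))%N.
  apply: count_groups => j jm qp; have /andP[_ g1] := kq j jm.
  apply: leq_trans g1 _; apply: sub_count => y /=; rewrite /atleast.
  by apply: le_trans.
have -> : count (side false p) s = count (predC (atleast p)) s.
  by apply: eq_count => y; rewrite /side /atleast /= ltNge.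
have := tk (atleast p); have := cA (atleast p) s; lia.
Qed.

(** Necessarily [p < t]: otherwise all numbers above [p], more than [k] of them, would lie above
    [t]. Hence the filter keeps every number above [t], and that count is unchanged. *)
Lemma kth_side_true s k p t : (k < count (above p) s)%N ->
  kth (seq.filter (side true p) s) k t -> kth s k t.
Proof.
move=> kp; rewrite /kth !count_filter => /andP[k1 k2].
have pt : p < t.
  rewrite ltNge; apply/negP => tp; move: k1; apply/negP; rewrite -ltnNge.
  apply: leq_trans kp _; apply: sub_count => y; rewrite /above /side /= => py.
  by rewrite py andbT (le_lt_trans tp).
apply/andP; split.
  rewrite (_ : count _ s = count (predI (above t) (side true p)) s) //.
  apply: eq_count => y; rewrite /above /side /=.
  by case ty: (t < y) => //=; rewrite (lt_trans pt).
by apply: leq_trans k2 _; apply: sub_count => y /andP[].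
Qed.

Lemma count_side_false s p (P : pred R) : (forall y, p <= y -> P y) ->
  count P s = (count (atleast p) s + count P (seq.filter (side false p) s))%N.
Proof.
move=> pP; rewrite count_filter.
elim: s => //= y s ->; rewrite /atleast /side ltNge.
case py: (p <= y) => /=; first by rewrite pP //= addnA.
by rewrite andbT add0n addnCA.
Qed.

(** Necessarily [t < p], since otherwise no filtered number would be at least [t]. So all discarded
    numbers exceed [t], and both counts shift by [count (atleast p) s]. *)
Lemma kth_side_false s k p t : (count (atleast p) s <= k)%N ->
  kth (seq.filter (side false p) s) (k - count (atleast p) s) t -> kth s k t.
Proof.
move=> kp /andP[k1 k2].
have tp : t < p.
  rewrite ltNge; apply/negP => pt.
  suff e : count (atleast t) (seq.filter (side false p) s) = 0%N by rewrite e in k2.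
  apply/eqP; rewrite -leqn0 leqNgt -has_count; apply/hasPn => y.
  by rewrite mem_filter /atleast => /andP[yp _]; rewrite -ltNge (lt_le_trans yp).
rewrite /kth (@count_side_false s p (above t)) => [|y py]; last exact: lt_le_trans py.
rewrite (@count_side_false s p (atleast t)) => [|y py].
  by apply/andP; lia.
exact/ltW/(lt_le_trans tp).
Qed.

End Pivot.

(** * Linear-time selection *)

Section Select.
Context (R : realType) (procs : seq cmd).
Context (p0 : nth Skip procs 0 = proc_select).
Context (p1 : nth Skip procs 1 = proc_count).
Context (p2 : nth Skip procs 2 = proc_brute).
Implicit Types (m : memory R) (s : seq R).

(** What a selection at depth [sp] may write: all arrays from 14 on, and the argument arrays at
    depth [sp] or deeper. The array of [v_sp] is excluded, since the depth is restored on return. *)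
Definition sel_nat sp a i := (14 <= a)%N || ((10 <= a) && (sp <= i))%N.
Definition sel_real top a i :=
  [|| (a == r_heap) && (top <= i)%N, a == r_res | a == r_piv].
(** The base case costs at most 400 * 30 * 30 plus a few units. Otherwise a level spends about 3200
    units per number (3000 on medians, 100 on counting, 100 on filtering) while the recursive calls
    leave out about a tenth of the numbers, so a constant well above 32000 suffices. *)
Definition sel_cost := (400 * 1000)%N.

Definition select_at n := forall m s a k sp top, size s = n ->
  nat_mem m v_sp 0 = sp -> nat_mem m v_la sp = a -> nat_mem m v_ln sp = size s ->
  nat_mem m v_lk sp = k -> nat_mem m v_lt sp = top -> (a + size s <= top)%N ->
  (k < size s)%N -> seg m a s ->
  wp procs (Call 0) m (fun t m' => [/\ (t <= sel_cost * size s)%N,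
    kth s k (real_mem m' r_res 0) & frame (sel_nat sp) (sel_real top) m m']).

Lemma select_filtered_spec up m s a k sp top x :
  select_at (size (seq.filter (side up x) s)) ->
  nat_mem m v_sp 0 = sp -> nat_mem m v_la sp = a -> nat_mem m v_ln sp = size s ->
  nat_mem m v_lk sp = k -> nat_mem m v_lt sp = top -> (a + size s <= top)%N ->
  real_mem m r_piv 0 = x ->
  (k < size (seq.filter (side up x) s))%N -> seg m a s ->
  wp procs (select_filtered up) m (fun t m' =>
    [/\ (t <= sel_cost * size (seq.filter (side up x) s) + 100 * size s + 200)%N,
    kth (seq.filter (side up x) s) k (real_mem m' r_res 0)
    & frame (sel_nat sp) (sel_real top) m m']).
Proof.
move=> IH spE aE nE kE tE atop xE kF sE.
apply: wp_seq; apply: wp_conseq (filter_spec procs up spE aE nE tE atop xE sE) _.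
move=> t m1 [tK fE sE1 F1].
do 3! (apply: wp_seq; apply: wp_nset => /=).
have [sp1 t1 k1] : [/\ nat_mem m1 v_sp 0 = sp, nat_mem m1 v_lt sp = top & nat_mem m1 v_lk sp = k].
  by split; rewrite F1.1.
rewrite !sp1 ?eqxx t1 fE.
apply: wp_conseq (IH _ (seq.filter (side up x) s) top k sp (top + size (seq.filter (side up x) s))%N _ _ _ _ _ _ _ _ _) _ => //=; rewrite ?eqxx //.
move=> t' m2 [tK' kt F2]; split=> //; first by lia.
have Fa : frame (sel_nat sp) (sel_real top) m m1.
  apply: frame_sub F1 => b i.
    by rewrite !inE /sel_nat => /orP[] /eqP->.
  by rewrite /sel_real => ->.
apply: frame_trans (frame_sub _ _ F2) => //.
  by do 3! (apply: frame_set_nat; last by rewrite /sel_nat !leqnn).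
move=> b i; rewrite /sel_real => /or3P[/andP[-> ti]|->|->]; rewrite ?orbT //.
by rewrite (leq_trans _ ti) ?leq_addr.
Qed.

Lemma medians_spec m s a sp top :
  nat_mem m v_sp 0 = sp -> nat_mem m v_la sp = a -> nat_mem m v_ln sp = size s ->
  nat_mem m v_lt sp = top -> (a + size s <= top)%N -> seg m a s ->
  wp procs medians_loop m (fun t m' => [/\ (t <= 3000 * size s + 20)%N,
    forall j, (j < size s %/ 5)%N ->
      kth (take 5 (drop (5 * j) s)) 2 (real_mem m' r_heap (top + j))
    & frame (fun a _ => 14 <= a)%N (sel_real top) m m']).
Proof.
move=> spE aE nE tE atop sE.
apply: wp_seq; apply: wp_nset => /=.
pose F := frame (R := R) (fun a _ => 14 <= a)%N (sel_real top).
pose Inv j m' := [/\ nat_mem m' v_g 0 = j,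
  forall j', (j' < j)%N ->
      kth (take 5 (drop (5 * j') s)) 2 (real_mem m' r_heap (top + j')) & F m m'].
(* By [brute_spec] a group of five costs at most 400 * 6 * 6; the 100 covers the assignments around
   the call. *)
apply: (wp_conseq (wp_while_const (K := 400 * 36 + 100) (Inv := Inv) (N := size s %/ 5) _ _ _)).
- by split=> //; apply: frame_set_nat.
- move=> j m' js [jE kE Fm].
  have spE' : nat_mem m' v_sp 0 = sp by rewrite Fm.1.
  have aE' : nat_mem m' v_la sp = a by rewrite Fm.1.
  have tE' : nat_mem m' v_lt sp = top by rewrite Fm.1.
  split; first by rewrite /= jE spE' Fm.1 // nE.
  have szg : size (take 5 (drop (5 * j) s)) = 5%N.
    by rewrite size_takel // size_drop; lia.
  do 3! (apply: wp_seq; apply: wp_nset => /=); rewrite jE spE' aE'.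
  apply: wp_seq; apply: wp_conseq (brute_spec (s := take 5 (drop (5 * j) s)) (a := a + 5 * j) (k := 2) p1 p2 _ _ _ _ _) _ => //=; rewrite ?szg //.
    move=> i; rewrite szg => i5 /=; rewrite nth_take // nth_drop Fm.2.
      by rewrite -addnA sE //; lia.
    by rewrite /sel_real /= orbF -ltnNge; lia.
  move=> t m1 [tK kt F1].
  have F2 : F m m1.
    apply: frame_trans (frame_sub _ _ F1); last 2 first.
    - by move=> b i /andP[].
    - by move=> b i; rewrite /sel_real !inE => ->; rewrite orbT.
    by do 3! apply: frame_set_nat => //.
  have [jE1 spE1 tE1] : [/\ nat_mem m1 v_g 0 = j, nat_mem m1 v_sp 0 = sp & nat_mem m1 v_lt sp = top].
    by split; rewrite F1.1.
  apply: wp_seq; apply: wp_rset => /=; apply: wp_nset => /=.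
  rewrite jE1 spE1 tE1; split; first by lia.
  rewrite /Inv addn1; split=> //=.
    move=> j'; rewrite ltnS leq_eqVlt eqn_add2l => /orP[/eqP->|j'j].
      by rewrite eqxx.
    by rewrite (ltn_eqF j'j) F1.2 //= kE.
  apply: frame_set_nat => //; apply: frame_set_real => //.
  by rewrite /sel_real eqxx leq_addr.
- by move=> m' [jE _ Fm] /=; rewrite jE (Fm.1 v_sp) // spE Fm.1 // nE ltnn.
move=> t m' [tN [_ kE Fm]]; split=> //.
by move: tN => /=; lia.
Qed.

(** For a cell that is changed and then set back: [v_sp] goes up before the call on the medians and
    down after it. *)
Lemma frame_restore NA RA m m' a i :
  frame (fun b j => NA b j || (b == a) && (j == i)) RA m m' ->
  nat_mem m' a i = nat_mem m a i -> frame NA RA m m'.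
Proof.
move=> [fN fR] e; split=> // b j H.
case bj: ((b == a) && (j == i)); first by case/andP: bj => /eqP-> /eqP->.
by rewrite fN // bj orbF.
Qed.

Lemma select_spec n : select_at n.
Proof.
elim/ltn_ind: n => n IH m s a k sp top sn spE aE nE kE tE atop ks sE.
apply: wp_call; rewrite p0; apply: wp_if.
have -> : eval_b m (NCmp CLt (loc v_ln) (NConst 30)) = (size s < 30)%N.
  by rewrite /= spE nE.
case: ltnP => s30.
  do 3! (apply: wp_seq; apply: wp_nset => /=); rewrite spE aE nE kE.
  apply: wp_conseq (brute_spec (s := s) (a := a) (k := k) p1 p2 _ _ _ _ _) _ => //.
  move=> t m1 [tK kt F1]; split=> //.
    by rewrite /sel_cost; nia.
  apply: frame_trans (frame_sub _ _ F1); last 2 first.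
  - by move=> b i /andP[bi _]; rewrite /sel_nat bi.
  - by move=> b i; rewrite /sel_real !inE => ->; rewrite orbT.
  by do 3! apply: frame_set_nat => //.
apply: wp_seq; apply: wp_conseq (medians_spec spE aE nE tE atop sE) _.
move=> tm m1 [tmK qE F1].
pose q j := real_mem m1 r_heap (top + j).
pose nm := (size s %/ 5)%N.
have F1' : frame (sel_nat sp) (sel_real top) m m1.
  by apply: frame_sub F1 => // b i bi; rewrite /sel_nat bi.
have [sp1 a1 n1] : [/\ nat_mem m1 v_sp 0 = sp, nat_mem m1 v_la sp = a &
  nat_mem m1 v_ln sp = size s] by split; rewrite F1.1.
have [k1 t1] : nat_mem m1 v_lk sp = k /\ nat_mem m1 v_lt sp = top by split; rewrite F1.1.
do 5! (apply: wp_seq; apply: wp_nset => /=).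
have neq : (sp == sp + 1)%N = false by rewrite addn1 ltn_eqF.
rewrite !sp1 !neq n1 t1 -/nm.
set m2 := set_nat _ _ _ _.
have F2 : frame (fun b i => sel_nat sp b i || (b == v_sp) && (i == 0%N)) (sel_real top) m1 m2.
  apply: frame_set_nat; last by rewrite /= ?orbT.
  by do 4! (apply: frame_set_nat; last by rewrite /sel_nat leq_addr).
have nmq : size (mkseq q nm) = nm by rewrite size_mkseq.
apply: wp_seq; apply: wp_conseq (IH nm _ m2 (mkseq q nm) top (nm %/ 2)%N (sp + 1)%N (top + nm)%N _ _ _ _ _ _ _ _ _) _ => //=; rewrite ?eqxx ?nmq //.
- by rewrite /nm; lia.
- by rewrite /nm; lia.
- by move=> i; rewrite nmq => il /=; rewrite nth_mkseq.
move=> t3 m3 [t3K kp F3].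
set p := real_mem m3 r_res 0 in kp.
have sp3 : nat_mem m3 v_sp 0 = (sp + 1)%N by rewrite F3.1.
apply: wp_seq; apply: wp_nset => /=; rewrite sp3 addnK.
set m4 := set_nat _ _ _ _.
have F4 : frame (sel_nat sp) (sel_real top) m1 m4.
  apply: (@frame_restore _ _ _ _ v_sp 0); last by rewrite /= sp1.
  apply: frame_set_nat; last by rewrite /= ?orbT.
  apply: frame_trans F2 (frame_sub _ _ F3).
    move=> b i; rewrite /sel_nat => /orP[->|/andP[-> spi]] //.
    by rewrite (leq_trans _ spi) ?leq_addr // orbT.
  move=> b i; rewrite /sel_real => /or3P[/andP[-> ti]|->|->]; rewrite ?orbT //.
  by rewrite (leq_trans _ ti) ?leq_addr.
have F4' := frame_trans F1' F4.
(* The call ran one level deeper, so the arguments at depth [sp] have survived. *)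
have r4 b : (b < 14)%N -> b != v_sp -> nat_mem m4 b sp = nat_mem m1 b sp.
  move=> b14 bsp; rewrite /m4 /= (negPf bsp) /= F3.1.
    by rewrite /m2 /= neq !andbF (negPf bsp).
  by rewrite /sel_nat addn1 ltnn andbF orbF -ltnNge.
do 2! (apply: wp_seq; apply: wp_nset => /=).
apply: wp_seq; apply: wp_rset => /=.
move: (r4 v_la isT isT) (r4 v_ln isT isT) (r4 v_lk isT isT) (r4 v_lt isT isT) => /= a4 n4 k4 t4.
rewrite a4 n4 a1 n1 -/p.
set m5 := set_real _ _ _ _.
have F5 : frame (sel_nat sp) (sel_real top) m m5.
  apply: frame_set_real; last by rewrite /sel_real !eqxx !orbT.
  by do 2! (apply: frame_set_nat => //).
have sE5 : seg m5 a s.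
  by move=> i il; rewrite F5.2 ?sE // /sel_real /= orbF -ltnNge; lia.
apply: wp_seq; apply: wp_conseq (count_spec (s := s) (a := a) (x := p) p1 _ _ sE5 _) _ => //.
move=> t6 m6 [t6K gtE geE F6].
have F6' : frame (sel_nat sp) (sel_real top) m m6.
  apply: frame_trans F5 (frame_sub _ _ F6) => // b i.
  by rewrite !inE => /or3P[] /eqP->.
have sE6 : seg m6 a s.
  by move=> i il; rewrite F6'.2 ?sE // /sel_real /= orbF -ltnNge; lia.
have p6 : real_mem m6 r_piv 0 = p by rewrite F6.2.
have pr6 : real_mem m6 r_res 0 = p by rewrite F6.2.
have sp6 : nat_mem m6 v_sp 0 = sp by rewrite F6.1.
have [a6 n6 k6 t6'] : [/\ nat_mem m6 v_la sp = a, nat_mem m6 v_ln sp = size s,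
    nat_mem m6 v_lk sp = k & nat_mem m6 v_lt sp = top].
  by split; rewrite F6.1 //=; [rewrite a4 | rewrite n4 | rewrite k4 | rewrite t4].
have [b1 b2] := pivot_balanced (erefl nm) qE kp.
(* The recursive calls handle [nm <= size s / 5] and [n' <= size s - 3 * (nm / 2)]
   elements, which leaves about [size s / 10] times [sel_cost] for the rest. *)
have arith t7 n' : (t7 <= sel_cost * n' + 100 * size s + 300)%N ->
  (n' + 3 * (nm - nm %/ 2) <= size s)%N ->
  (tm + t3 + t6 + t7 + 500 <= sel_cost * size s)%N.
  by move: tmK t3K t6K; rewrite /sel_cost /nm; lia.
apply: wp_if.
have -> : eval_b m6 (NCmp CLt (loc v_lk) (cell v_gt)) = (k < count (above p) s)%N.
  by rewrite /= sp6 k6 gtE.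
case: ltnP => kgt.
  have cF : size (seq.filter (side true p) s) = count (above p) s.
    by rewrite size_filter; apply: eq_count.
  apply: wp_conseq (select_filtered_spec (up := true) (s := s) (k := k) (x := p) _ sp6 a6 n6 k6 t6' atop p6 _ sE6) _.
  - by apply: IH; rewrite cF -sn; move: b1; rewrite /nm; lia.
  - by rewrite cF.
  move=> t7 m7 [t7K kt F7]; split.
  + rewrite cF in t7K.
    by move: (arith t7 _ (leq_trans t7K (leq_add (leqnn _) (isT : (200 <= 300)%N))) b1) => /=; lia.
  + exact: kth_side_true kt.
  + exact: frame_trans F6' F7.
apply: wp_if.
have -> : eval_b m6 (NCmp CLt (loc v_lk) (cell v_ge)) = (k < count (atleast p) s)%N.
  by rewrite /= sp6 k6 geE.
case: ltnP => kge.
  (* The rank [k] lies in the interval of the pivot, which is still in [r_res] because counting does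
     not write there. *)
  apply: wp_skip; split=> //.
  + by move: (arith 0 0); rewrite /=; lia.
  + by rewrite pr6 /kth kgt.
apply: wp_seq; apply: wp_nset => /=; rewrite sp6 k6 geE.
set m7 := set_nat _ _ _ _.
have F7 : frame (sel_nat sp) (sel_real top) m m7.
  by apply: frame_set_nat => //; rewrite /sel_nat !leqnn.
have cF : size (seq.filter (side false p) s) = count (side false p) s.
  by rewrite size_filter.
have cAll : (count (atleast p) s + count (side false p) s = size s)%N.
  by rewrite -(count_predC (atleast p) s); congr addn; apply: eq_count => y; rewrite /side /atleast /= ltNge.
apply: wp_conseq (select_filtered_spec (up := false) (m := m7) (s := s) (a := a) (k := k - count (atleast p) s) (sp := sp) (top := top) (x := p) _ _ _ _ _ _ _ _ _ _) _ => //=; rewrite ?eqxx //.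
- by apply: IH; rewrite cF -sn; move: b2; rewrite /nm; lia.
- by rewrite cF; lia.
move=> t8 m8 [t8K kt F8]; split.
+ rewrite cF in t8K.
    by move: (arith t8 _ (leq_trans t8K (leq_add (leqnn _) (isT : (200 <= 300)%N))) b2) => /=; lia.
+ exact: kth_side_false kt.
+ exact: frame_trans F7 F8.
Qed.

End Select.

(** * The main program *)

Definition in_array a := NGet a (cell v_x).

Definition degree_phase : cmd :=
  v_x ::= NConst 0 ;;
  While (NCmp CLt (cell v_x) (NGet arr_params (NConst 0)))
   (If (BAnd (NCmp CEq (in_array arr_benign) (NConst 0))
             (NCmp CEq (in_array arr_sybil) (NConst 0)))
      (v_c ::= in_array arr_head ;;
       While (BNot (NCmp CEq (cell v_c) (NConst 0)))
        (let v := NGet arr_dest (cell v_c) in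
         NSet v_deg v (NOp NAdd (NGet v_deg v) (NConst 1)) ;;
         v_c ::= NGet arr_next (cell v_c)))
      Skip ;;
    incr v_x).

Definition weight_phase : cmd :=
  v_x ::= NConst 0 ;; v_fo ::= NConst 0 ;;
  While (NCmp CLt (cell v_x) (NGet arr_params (NConst 0)))
   (RSet r_wt (cell v_x) (ROp RMul (ROp RSub (ROfNat (NConst 1)) (RGet arr_pr (cell v_x)))
                                   (ROfNat (in_array v_deg))) ;;
    If (NCmp CEq (in_array arr_benign) (NConst 1))
      (RSet r_heap (cell v_fo) (RGet r_wt (cell v_x)) ;; incr v_fo) Skip ;;
    incr v_x).

(** The counter [v_c] is not reset between the two passes: it holds the number of nodes output so
    far, which [tie_test] compares with the budget. *)
Definition output_pass (b : bexp) : cmd :=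
  v_x ::= NConst 0 ;;
  While (NCmp CLt (cell v_x) (NGet arr_params (NConst 0)))
   (If (BAnd (NCmp CEq (in_array arr_benign) (NConst 1)) b)
      (NSet arr_output (cell v_x) (NConst 1) ;; incr v_c) Skip ;;
    incr v_x).

Definition above_test := RCmp CLt (rcell r_res) (RGet r_wt (cell v_x)).
Definition tie_test := BAnd (NCmp CLt (cell v_c) (NGet arr_params (NConst 1)))
                            (RCmp CEq (rcell r_res) (RGet r_wt (cell v_x))).

Definition output_phase : cmd :=
  v_c ::= NConst 0 ;; output_pass above_test ;; output_pass tie_test.

(** Ranks count from 0, hence the budget minus 1. The weights fill the heap below index [v_fo],
    which is thus both the segment length and the first free cell. *)
Definition threshold_phase : cmd :=
  NSet v_la (cell v_sp) (NConst 0) ;;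
  NSet v_ln (cell v_sp) (cell v_fo) ;;
  NSet v_lk (cell v_sp) (NOp NSub (NGet arr_params (NConst 1)) (NConst 1)) ;;
  NSet v_lt (cell v_sp) (cell v_fo) ;;
  Call 0.

(** With budget 0 there is no rank to select, and the output array, initially zero, already
    represents the empty set. *)
Definition selection_program : program :=
  Program [:: proc_select; proc_count; proc_brute]
   (If (NCmp CEq (NGet arr_params (NConst 1)) (NConst 0)) Skip
     (degree_phase ;; weight_phase ;; threshold_phase ;; output_phase)).

(** * Correctness and running time of the main program *)

Section Main.
Context (R : realType) (V : finType) (I : instance R V) (id : V -> nat)
  (adj : V -> seq V) (m0 : memory R) (rep : represents I id adj m0).
Implicit Types (m : memory R) (u v : V) (A : {set V}).
Local Notation procs := (procedures selection_program).

(** An injection between finite sets of equal size is onto; this turns a loop counter back into a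
    node. *)
Lemma node_at j : (j < #|V|)%N -> exists v, id v = j.
Proof.
move=> jV; pose f v : 'I_#|V| := Ordinal (id_lt rep v).
have fI : injective f by move=> u v [] /(id_inj rep).
have /codomP[v vE] : Ordinal jV \in codom f.
  by apply: (inj_card_onto fI); rewrite card_ord.
by exists v; move: (congr1 val vE) => /= ->.
Qed.

Lemma card_id_ltS (Q : pred V) v :
  #|[set u | (id u < (id v).+1)%N && Q u]| = (#|[set u | (id u < id v)%N && Q u]| + Q v)%N.
Proof.
rewrite (cardsD1 v) inE ltnSn /= addnC; congr addn; apply: eq_card => u.
by rewrite !inE ltnS ltn_neqAle (inj_eq (id_inj rep)) andbA.
Qed.

(** Converts the bound of [wp_while], a sum over loop counters, into a sum over nodes. *)
Lemma sum_by_id (F : V -> nat) :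
  (\sum_(0 <= j < #|V|) \sum_(v | id v == j) F v = \sum_v F v)%N.
Proof.
by rewrite big_mkord (partition_big (fun v => Ordinal (id_lt rep v)) xpredT) //=.
Qed.

Lemma sum_at_id (F : V -> nat) v : (\sum_(u | id u == id v) F u)%N = F v.
Proof. by rewrite (big_pred1 v) // => u /=; rewrite (inj_eq (id_inj rep)). Qed.

Lemma sum_size_adj : (\sum_u size (adj u))%N = #|edges I|.
Proof.
rewrite -sum1_card (eq_bigl (fun e => xpredT e.1 && ((e.1, e.2) \in edges I))); last by case.
rewrite -(pair_big_dep xpredT (fun u v => (u, v) \in edges I) (fun _ _ => 1%N)) /=.
apply: eq_bigr => u _; rewrite sum1_card -(card_uniqP (adj_uniq rep u)).
by apply: eq_card => v; rewrite (adj_edges rep).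
Qed.

Lemma linked_list_frame m m' dest next c s :
  (forall i, nat_mem m' dest i = nat_mem m dest i) ->
  (forall i, nat_mem m' next i = nat_mem m next i) ->
  linked_list m dest next c s -> linked_list m' dest next c s.
Proof.
move=> dE nE; elim: s c => //= x s IH c [c0 cx cs].
by split; rewrite ?dE ?nE //; apply: IH.
Qed.

Definition degree_before j v :=
  #|[set u | (id u < j)%N && ((u \notin benign I :|: sybil I) && ((u, v) \in edges I))]|.

Lemma traversal_spec m (s : seq V) : uniq s ->
  linked_list m arr_dest arr_next (nat_mem m v_c 0) [seq id v | v <- s] ->
  wp procs
    (While (BNot (NCmp CEq (cell v_c) (NConst 0)))
        (let v := NGet arr_dest (cell v_c) in
         NSet v_deg v (NOp NAdd (NGet v_deg v) (NConst 1)) ;;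
         v_c ::= NGet arr_next (cell v_c))) m
    (fun t m' => [/\ (t <= 60 * (size s).+1)%N,
       forall v, nat_mem m' v_deg (id v) = (nat_mem m v_deg (id v) + (v \in s))%N &
       frame (fun a _ => a \in [:: v_deg; v_c]) (fun _ _ => false) m m']).
Proof.
move=> us ls.
pose F := frame (R := R) (fun a _ => a \in [:: v_deg; v_c]) (fun _ _ => false).
pose Inv j m' := [/\ linked_list m' arr_dest arr_next (nat_mem m' v_c 0) [seq id v | v <- drop j s],
  forall v, nat_mem m' v_deg (id v) = (nat_mem m v_deg (id v) + (v \in take j s))%N & F m m'].
apply: (wp_conseq (wp_while_const (K := 40) (Inv := Inv) (N := size s) _ _ _)).
- by rewrite /Inv drop0 take0; split=> // v; rewrite addn0.
- move=> j m' js [lE dE Fm].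
  have [x0 _] : exists x0 : V, true by case: (s) js => // x0; exists x0.
  rewrite (drop_nth x0) //= in lE; case: lE => c0 dx ln.
  split; first by rewrite /=; apply/eqP.
  apply: wp_seq; apply: wp_nset => /=; apply: wp_nset => /=.
  split=> //; rewrite /Inv /= dx; split.
  + by apply: linked_list_frame ln.
  + move=> v; rewrite (take_nth x0) // mem_rcons inE (inj_eq (id_inj rep)).
    (* Since [s] has no repetition, the current node is not in the prefix already counted, and its
       counter grows only once. *)
    have := take_uniq j.+1 us; rewrite (take_nth x0) // rcons_uniq => /andP[/negPf nt _].
    by case: eqP => [->|_] /=; rewrite dE // nt addn0.
  + by do 2! apply: frame_set_nat => //.
- by move=> m' [lE _ _] /=; rewrite drop_size /= in lE; rewrite lE.
move=> t m' [tN [_ dE Fm]]; rewrite take_size in dE; split=> //.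
by move: tN => /=; lia.
Qed.

Lemma degree_spec :
  wp procs degree_phase m0 (fun t m' => [/\ (t <= 200 * (#|V| + #|edges I|).+1)%N,
    forall v, nat_mem m' v_deg (id v) = #|in_neighbors I v :\: (benign I :|: sybil I)| &
    frame (fun a _ => a \in [:: v_deg; v_x; v_c]) (fun _ _ => false) m0 m']).
Proof.
apply: wp_seq; apply: wp_nset => /=.
pose F := frame (R := R) (fun a _ => a \in [:: v_deg; v_x; v_c]) (fun _ _ => false).
pose Inv j m' := [/\ nat_mem m' v_x 0 = j,
  forall v, nat_mem m' v_deg (id v) = degree_before j v & F m0 m'].
(* The cost of iteration [j] is a sum over the single node numbered [j], which avoids an inverse of
   [id]. *)
apply: (wp_conseq (wp_while (K := fun j => (\sum_(v | id v == j) (60 * size (adj v) + 120))%N) (Inv := Inv) (N := #|V|) _ _ _)).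
- split=> //.
    move=> v /=; rewrite (nat_mem_init rep) // /degree_before.
    by apply/esym/eqP; rewrite cards_eq0; apply/eqP/setP => u; rewrite !inE.
  by apply: frame_set_nat.
- move=> j m' js [jE dE Fm]; have [v vE] := node_at js.
  split; first by rewrite /= jE Fm.1 // (repr_size rep).
  rewrite -vE sum_at_id vE.
  have degS u : degree_before j.+1 u =
      (degree_before j u + ((v \notin benign I :|: sybil I) && ((v, u) \in edges I)))%N.
    by rewrite /degree_before -vE card_id_ltS.
  apply: wp_seq; apply: wp_if.
  have -> : eval_b m' (BAnd (NCmp CEq (in_array arr_benign) (NConst 0))
             (NCmp CEq (in_array arr_sybil) (NConst 0))) = (v \notin benign I :|: sybil I).
    rewrite /= jE !Fm.1 // -vE (repr_benign rep) (repr_sybil rep) inE negb_or.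
    by case: (v \in benign I); case: (v \in sybil I).
  case: ifPn => vBS; last first.
    apply: wp_skip; apply: wp_nset => /=; split; first by lia.
    rewrite /Inv jE addn1; split=> //=.
      by move=> u; rewrite degS (negPf vBS) addn0.
    by apply: frame_set_nat.
  apply: wp_seq; apply: wp_nset => /=.
  apply: wp_conseq (traversal_spec (adj_uniq rep v) _) _.
    rewrite /= jE Fm.1 // -vE; apply: linked_list_frame (repr_adj rep v) => i /=;
    by rewrite Fm.1.
  move=> t m1 [tK dE1 F1]; apply: wp_nset => /=.
  split; first by lia.
  rewrite /Inv /= F1.1 //= jE addn1; split=> //.
    by move=> u; rewrite dE1 /= dE degS vBS (adj_edges rep).
  apply: frame_set_nat => //; apply: frame_trans (frame_sub _ _ F1) => //.
    by apply: frame_set_nat.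
  by move=> b i; rewrite !inE => /orP[]->; rewrite ?orbT.
- by move=> m' [jE _ Fm] /=; rewrite jE Fm.1 // (repr_size rep) ltnn.
move=> t m' [tN [_ dE Fm]]; split=> //.
  move: tN; rewrite big_split /= sum_by_id big_split /= -big_distrr /= sum_size_adj.
  rewrite !sum_nat_const sum_nat_const_nat [#|xpredT|](_ : _ = #|V|); last exact: eq_card.
  have arith (n e : nat) : (t <= 60 * e + n * 120 + (n - 0) * 6 + 6 -> 3 + t <= 200 * (n + e).+1)%N by lia.
  exact: arith.
move=> v; rewrite dE; apply: eq_card => u; rewrite !inE.
by rewrite (id_lt rep).
Qed.

(** The list [s] of benign weights is described only through its counts, which is all that ranks
    depend on. *)
Lemma weight_spec m :
  (forall v, nat_mem m v_deg (id v) = #|in_neighbors I v :\: (benign I :|: sybil I)|) ->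
  frame (fun a _ => a \in [:: v_deg; v_x; v_c]) (fun _ _ => false) m0 m ->
  wp procs weight_phase m (fun t m' => [/\ (t <= 200 * (#|V|).+1)%N,
    forall v, real_mem m' r_wt (id v) = weight I v,
    frame (fun a _ => a \in [:: v_deg; v_x; v_c; v_fo])
      (fun a _ => a \in [:: r_heap; r_wt]) m0 m' &
    exists s, [/\ nat_mem m' v_fo 0 = size s, seg m' 0 s &
      forall P : pred R, count P s = #|[set v in benign I | P (weight I v)]|]]).
Proof.
move=> dE F0.
do 2! (apply: wp_seq; apply: wp_nset => /=).
pose F := frame (R := R) (fun a _ => a \in [:: v_x; v_fo])
      (fun a _ => a \in [:: r_heap; r_wt]).
pose Inv j m' := [/\ nat_mem m' v_x 0 = j,
  forall v, (id v < j)%N -> real_mem m' r_wt (id v) = weight I v, F m m' &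
  exists s, [/\ nat_mem m' v_fo 0 = size s, seg m' 0 s &
    forall P : pred R, count P s = #|[set v | (id v < j)%N && ((v \in benign I) && P (weight I v))]|]].
apply: (wp_conseq (wp_while_const (K := 60) (Inv := Inv) (N := #|V|) _ _ _)).
- split=> //; first by do 2! apply: frame_set_nat => //.
  exists [::]; split=> // P /=.
  by apply/esym/eqP; rewrite cards_eq0; apply/eqP/setP => u; rewrite !inE.
- move=> j m' js [jE wE Fm [s [fE sE cE]]]; have [v vE] := node_at js.
  split; first by rewrite /= jE Fm.1 // F0.1 // (repr_size rep).
  have dv : nat_mem m' v_deg j = #|in_neighbors I v :\: (benign I :|: sybil I)|.
    by rewrite Fm.1 // -vE dE.
  have pv : real_mem m' arr_pr j = pr I v by rewrite Fm.2 // F0.2 // -vE (repr_pr rep).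
  have bv : nat_mem m' arr_benign j = (v \in benign I).
    by rewrite Fm.1 // F0.1 // -vE (repr_benign rep).
  apply: wp_seq; apply: wp_rset => /=; rewrite jE dv pv -/(weight I v).
  apply: wp_seq; apply: wp_if => /=; rewrite jE bv.
  have wS u : (id u < j.+1)%N ->
    (if id u == j then weight I v else real_mem m' r_wt (id u)) = weight I u.
    rewrite ltnS leq_eqVlt -vE (inj_eq (id_inj rep)); case: eqP => [->|_] //=.
    by rewrite vE; apply: wE.
  case: (boolP (v \in benign I)) => vB /=.
    apply: wp_seq; apply: wp_rset => /=; rewrite jE fE eqxx.
    apply: wp_nset => /=; apply: wp_nset => /=; rewrite jE fE !addn1.
    split=> //; split=> //=.
      do 2! apply: frame_set_nat => //.
      by do 2! apply: frame_set_real => //.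
    exists (rcons s (weight I v)); rewrite size_rcons; split=> //.
      move=> i; rewrite size_rcons ltnS leq_eqVlt nth_rcons /= add0n => /orP[/eqP->|il].
        by rewrite ltnn eqxx.
      by rewrite il (ltn_eqF il) -[i in LHS]add0n sE.
    move=> P; rewrite -cats1 count_cat /= addn0 cE -vE card_id_ltS.
    by rewrite vB.
  apply: wp_skip; apply: wp_nset => /=; rewrite jE !addn1.
  split=> //; split=> //=.
    by apply: frame_set_nat => //; apply: frame_set_real.
  exists s; split=> // P.
  by rewrite cE -vE card_id_ltS (negPf vB) addn0.
- by move=> m' [jE _ Fm _] /=; rewrite jE Fm.1 // F0.1 // (repr_size rep) ltnn.
move=> t m' [tN [_ wE Fm [s [fE sE cE]]]]; split=> //.
- by move: tN => /=; lia.
- by move=> v; apply: wE; apply: id_lt rep v.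
- apply: frame_trans (frame_sub _ _ F0) (frame_sub _ _ Fm) => // b i;
  by rewrite !inE; lia.
exists s; split=> // P; rewrite cE; apply: eq_card => v.
by rewrite !inE (id_lt rep).
Qed.

Lemma threshold_spec m s k :
  nat_mem m v_sp 0 = 0%N -> nat_mem m v_fo 0 = size s -> seg m 0 s ->
  nat_mem m arr_params 1 = k.+1 -> (k < size s)%N ->
  wp procs threshold_phase m (fun t m' => [/\ (t <= sel_cost * size s + 100)%N,
    kth s k (real_mem m' r_res 0) &
    frame (fun a _ => 10 <= a)%N (fun a _ => a \in [:: r_heap; r_res; r_piv]) m m']).
Proof.
move=> spE fE sE kE ks.
do 4! (apply: wp_seq; apply: wp_nset => /=); rewrite spE fE kE subn1 /=.
apply: wp_conseq (select_spec (procs := procs) erefl erefl erefl (n := size s) (s := s)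
  (a := 0%N) (k := k) (sp := 0%N) (top := size s) _ _ _ _ _ _ _ _ _) _ => //.
move=> t m' [tK kt Fm]; split=> //; first by lia.
apply: frame_trans (frame_sub _ _ Fm).
- by do 4! apply: frame_set_nat => //.
- by move=> b i; rewrite /sel_nat; lia.
- by move=> b i; rewrite /sel_real !inE => /or3P[/andP[-> _]|->|->]; rewrite ?orbT.
Qed.

(** * Output of the nodes above the threshold and of enough ties *)

Definition output_frame := frame (R := R)
  (fun a _ => a \in [:: arr_output; v_x; v_c]) (fun _ _ => false).

(** One rule for both passes. The decision [test A v] may depend on the set [A] output so far, of
    which the program knows only the size; [v \notin A] keeps [v_c] equal to that size. [Q j A] is
    the invariant after visiting the nodes numbered below [j]. *)
Lemma output_pass_spec b (test : {set V} -> V -> bool) (Q : nat -> {set V} -> Prop) m (A0 : {set V}) :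
  (cost_b b <= 20)%N ->
  nat_mem m arr_params 0 = #|V| ->
  (forall v, nat_mem m arr_benign (id v) = (v \in benign I)) ->
  (forall v A m', output_frame m m' -> nat_mem m' v_x 0 = id v ->
     nat_mem m' v_c 0 = #|A| -> eval_b m' b = test A v) ->
  (forall v A, Q (id v) A -> if (v \in benign I) && test A v
     then v \notin A /\ Q (id v).+1 (v |: A) else Q (id v).+1 A) ->
  outputs id m A0 -> nat_mem m v_c 0 = #|A0| -> Q 0%N A0 ->
  wp procs (output_pass b) m (fun t m' => [/\ (t <= 100 * (#|V|).+1)%N,
    output_frame m m' & exists A, [/\ outputs id m' A, nat_mem m' v_c 0 = #|A| & Q #|V| A]]).
Proof.
move=> bK nE bE tE Qs o0 c0 Q0.
apply: wp_seq; apply: wp_nset => /=.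
pose Inv j m' := [/\ nat_mem m' v_x 0 = j, output_frame m m' &
  exists A, [/\ outputs id m' A, nat_mem m' v_c 0 = #|A| & Q j A]].
apply: (wp_conseq (wp_while_const (K := 60) (Inv := Inv) (N := #|V|) _ _ _)).
- split=> //; first by apply: frame_set_nat.
  by exists A0.
- move=> j m' js [jE Fm [A [oA cA QA]]]; have [v vE] := node_at js.
  split; first by rewrite /= jE Fm.1 // nE.
  apply: wp_seq; apply: wp_if.
  have -> : eval_b m' (BAnd (NCmp CEq (in_array arr_benign) (NConst 1)) b) =
      (v \in benign I) && test A v.
    rewrite /= jE Fm.1 // -vE bE (tE v A) // ?jE //.
    by case: (v \in benign I).
  have := Qs v A; rewrite vE => /(_ QA).
  case: ifP => _.
    move=> [vA QA']; apply: wp_seq; apply: wp_nset => /=; rewrite jE.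
    apply: wp_nset => /=; apply: wp_nset => /=; rewrite jE !addn1.
    split; first by lia.
    split=> //=; first by do 3! apply: frame_set_nat => //.
    exists (v |: A); split=> //=; last by rewrite cardsU1 vA cA.
    move=> u /=; rewrite oA -vE (inj_eq (id_inj rep)) in_setU1.
    by case: eqP.
  move=> QA'; apply: wp_skip; apply: wp_nset => /=; rewrite jE !addn1.
  split; first by lia.
  split=> //=; first by apply: frame_set_nat.
  by exists A.
- by move=> m' [jE Fm _] /=; rewrite jE Fm.1 // nE ltnn.
move=> t m' [tN [_ Fm ex]]; split=> //.
by move: tN => /=; lia.
Qed.

Lemma output_spec m s k (x : R) :
  budget I = k.+1 ->
  (forall P : pred R, count P s = #|[set v in benign I | P (weight I v)]|) ->
  kth s k x -> real_mem m r_res 0 = x ->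
  nat_mem m arr_params 0 = #|V| -> nat_mem m arr_params 1 = budget I ->
  (forall v, nat_mem m arr_benign (id v) = (v \in benign I)) ->
  (forall v, real_mem m r_wt (id v) = weight I v) ->
  (forall i, nat_mem m arr_output i = 0%N) ->
  wp procs output_phase m (fun t m' => (t <= 300 * (#|V|).+1)%N /\
    exists A, outputs id m' A /\ highest_weights I A).
Proof.
move=> kE cE /andP[k1 k2] xE nE bE BE wE oE.
apply: wp_seq; apply: wp_nset => /=.
set m1 := set_nat _ _ _ _.
pose w := weight I.
pose Q1 j (A : {set V}) := A = [set v | (id v < j)%N && ((v \in benign I) && (x < w v))].
apply: wp_seq; apply: wp_conseq (@output_pass_spec above_test (fun _ v => x < w v) Q1 m1 finset.set0 _ _ _ _ _ _ _ _) _ => //.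
- by move=> v A m' Fm vE cA /=; rewrite !Fm.2 //= vE xE wE.
- move=> v A ->; have idS u : (id u < (id v).+1)%N = (u == v) || (id u < id v)%N.
    by rewrite ltnS leq_eqVlt (inj_eq (id_inj rep)).
  case: ifP => b.
    split; first by rewrite inE ltnn.
    apply/finset.setP => u; rewrite !inE idS.
    by case: eqP => [->|]; rewrite //= b.
  apply/finset.setP => u; rewrite !inE idS.
  by case: eqP => [->|]; rewrite //= ltnn b.
- by move=> v /=; rewrite oE inE.
- by rewrite /= cards0.
move=> t1 m2 [t1K F1 [A1 [out1 cc1 A1E]]].
have {}A1E : A1 = [set v in benign I | x < w v].
  by rewrite A1E; apply/finset.setP => v; rewrite !inE (id_lt rep).
have A1k : (#|A1| <= k)%N by rewrite A1E -cE.
(* The last clause says that a visited tie is left out only when the budget is exhausted. *)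
pose Q2 j (A : {set V}) := [/\ A1 \subset A, (#|A| <= k.+1)%N,
  forall v, v \in A -> (v \in A1) || [&& v \in benign I, x == w v & (id v < j)%N] &
  (#|A| < k.+1)%N -> forall v, v \in benign I -> x = w v -> (id v < j)%N -> v \in A].
apply: wp_conseq (@output_pass_spec tie_test (fun A v => (#|A| < k.+1)%N && (x == w v)) Q2 m2 A1 _ _ _ _ _ _ _ _) _ => //.
- by rewrite F1.1.
- by move=> v; rewrite F1.1 //= BE.
- move=> v A m' Fm vE cA.
  have k' : nat_mem m' arr_params 1 = k.+1 by rewrite Fm.1 // F1.1 //= bE.
  have x' : real_mem m' r_res 0 = x by rewrite Fm.2 // F1.2.
  have w' : real_mem m' r_wt (id v) = w v by rewrite Fm.2 // F1.2 //= wE.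
  by rewrite /= cA k' vE x' w'.
- move=> v A [sA Ak Ain Aall].
  have idS u : (id u < (id v).+1)%N = (u == v) || (id u < id v)%N.
    by rewrite ltnS leq_eqVlt (inj_eq (id_inj rep)).
  case: ifP => [/and3P[vB Ak1 /eqP xv]|nb].
    have vA : v \notin A.
      by apply/negP => /Ain; rewrite A1E inE -xv ltxx ltnn !andbF.
    split=> //; split.
    + by apply: fintype.subset_trans sA _; apply: finset.subsetUr.
    + by rewrite cardsU1 vA.
    + move=> u /setU1P[->|/Ain/orP[->//|/and3P[-> -> uv]]].
        by rewrite vB xv eqxx ltnSn orbT.
      by rewrite idS uv !orbT.
    + move=> cA u uB xu; rewrite idS in_setU1 => /orP[->//|uv].
      by rewrite Aall ?orbT.
  split=> //.
    by move=> u /Ain/orP[->//|/and3P[-> -> uv]]; rewrite idS uv !orbT.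
  move=> cA u uB xu; rewrite idS => /orP[/eqP uv|]; last exact: Aall.
  by move: nb; rewrite -uv uB cA xu eqxx.
- by split=> //; [exact: leqW | move=> v ->].
move=> t2 m3 [t2K F2 [A [oA cA [sA Ak Ain Aall]]]].
have arith (n : nat) : (t1 <= 100 * n.+1 -> t2 <= 100 * n.+1 ->
  3 + (t1 + t2) <= 300 * n.+1)%N by lia.
split; first exact: arith.
exists A; split=> //.
have Ax v : v \in A -> v \in benign I /\ x <= w v.
  move=> /Ain; rewrite A1E inE => /orP[/andP[-> /ltW]|/and3P[-> /eqP-> _]] //.
(* If [A] were smaller it would contain every tie, hence every benign node of weight at least [x];
   by [k2] there are more than [k] of those. *)
have cAk : #|A| = k.+1.
  apply/eqP; rewrite eqn_leq Ak ltnNge -ltnS /=; apply/negP => cAk.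
  move: k2; apply/negP; rewrite -leqNgt cE.
  have cAk' := cAk; apply: leq_trans (subset_leq_card _) cAk'; apply/fintype.subsetP => v.
  rewrite inE => /andP[vB]; rewrite /atleast le_eqVlt => /orP[/eqP xv|xv].
    exact: (Aall cAk v vB xv (id_lt rep v)).
  by apply: (fintype.subsetP sA); rewrite A1E inE vB.
split.
  by split; [apply/fintype.subsetP => v /Ax[] | rewrite cAk kE].
(* The threshold [x] separates: nodes of [A] weigh at least [x], and a benign node heavier than [x]
   lies in [A1], hence in [A]. *)
move=> u v /Ax[_ xu]; rewrite inE => /andP[vA vB].
apply: le_trans xu; rewrite leNgt; apply/negP => xv; move: vA; apply/negP.
by rewrite negbK; apply: (fintype.subsetP sA); rewrite A1E inE vB.
Qed.

Lemma selection_program_spec : (budget I <= #|benign I|)%N ->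
  wp procs (main selection_program) m0 (fun t m' =>
    (t <= (sel_cost + 1000) * (#|V| + #|edges I| + 1))%N /\
    exists A, outputs id m' A /\ highest_weights I A).
Proof.
move=> kB; apply: wp_if => /=; rewrite (repr_budget rep).
have pos : (0 < #|V| + #|edges I| + 1)%N by rewrite addn1.
case: eqP => [k0|/eqP]; last rewrite -lt0n => k0.
  apply: wp_skip; split; first by rewrite /sel_cost /=; lia.
  exists finset.set0; split; first by move=> v; rewrite (nat_mem_init rep) // inE.
  by split; [split; rewrite ?finset.sub0set // cards0 k0 | move=> v u; rewrite inE].
apply: wp_seq; apply: wp_conseq degree_spec _ => t1 m1 [t1K dE F1].
apply: wp_seq; apply: wp_conseq (weight_spec dE F1) _ => t2 m2 [t2K wE F2 [s [fE sE cE]]].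
have sB : size s = #|benign I|.
  by rewrite -(count_predT s) cE; apply: eq_card => v; rewrite inE andbT.
have kE : budget I = (budget I).-1.+1 by rewrite prednK.
apply: wp_seq; apply: wp_conseq (@threshold_spec m2 s (budget I).-1 _ fE sE _ _) _.
- by rewrite F2.1 // (nat_mem_init rep).
- by rewrite F2.1 // (repr_budget rep).
- by rewrite sB -kE.
move=> t3 m3 [t3K kx F3].
apply: wp_conseq (@output_spec m3 s (budget I).-1 _ kE cE kx erefl _ _ _ _ _) _.
- by rewrite F3.1 // F2.1 // (repr_size rep).
- by rewrite F3.1 // F2.1 // (repr_budget rep).
- by move=> v; rewrite F3.1 // F2.1 // (repr_benign rep).
- by move=> v; rewrite F3.2.
- by move=> i; rewrite F3.1 // F2.1 // (nat_mem_init rep).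
move=> t4 m4 [t4K ex]; split=> //.
have : (#|benign I| <= #|V|)%N by apply: max_card.
rewrite sB in t3K.
have arith (n e b : nat) : (t1 <= 200 * (n + e).+1 -> t2 <= 200 * n.+1 ->
    t3 <= sel_cost * b + 100 -> t4 <= 300 * n.+1 -> b <= n ->
    (t1 + (t2 + (t3 + t4)) + 4).+1 <= (sel_cost + 1000) * (n + e + 1))%N.
  by rewrite /sel_cost; lia.
move=> bV; apply: leq_trans (arith _ _ _ t1K t2K t3K t4K bV); lia.
Qed.

End Main.

Lemma selection_program_correct (R : realType) :
  computes_highest_weights_in_linear_time R selection_program.
Proof.
exists (sel_cost + 1000)%N => V I id adj m kB rep.
have [t [m' [run [tK [A [oA hA]]]]]] := selection_program_spec rep kB.
by exists t, m', A; split.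
Qed.

Theorem mainTheorem2 (R : realType) :
  (forall (V : finType) (I : instance R V)
     (d : measure_display) (T : measurableType d) (P : probability T R)
     (r : V -> {RV P >-> bool}) (A : {set V}),
     resistances I r -> (budget I <= #|benign I|)%N ->
     highest_weights I A -> optimal I r A) /\
  (exists p : program, computes_highest_weights_in_linear_time R p).
Proof.
split; last by exists selection_program; apply: selection_program_correct.
by move=> V I d T P r A rI _; apply: highest_weights_optimal.
Qed.
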